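(* Let $M_2^s$ be the set of uniform probability distributions on $s$-point subsets of $\mathbb{R}^2$, equipped with the earth mover's distance. Then $c_1(M_2^s)=\Omega(\log s)$; that is, there is an absolute constant $c>0$ with $c_1(M_2^s)\ge c\log s$ for all sufficiently large $s$.
   Context: $\mathbb{R}^2$ is equipped with the $\ell_1$-metric (the Euclidean metric gives the same asymptotic statement, the two being equivalent up to a factor $\sqrt2$). The earth mover's distance between finitely supported probability measures $\mu,\nu$ on a metric space $(X,d)$ is $\mathrm{EMD}(\mu,\nu)=\inf\sum_ia_id(x_i,y_i)$ over all representations $\mu-\nu=\sum_ia_i(\delta_{x_i}-\delta_{y_i})$ with $a_i\ge0$. For a metric space $Y$, $c_1(Y)$ is the infimal $D\ge1$ such that some map $F$ of $Y$ into an $L_1$-space satisfies $\rho(x,y)\le\|F(x)-F(y)\|_1\le D\rho(x,y)$. *)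

(* Defs.v *)
From HB Require Import structures.
From mathcomp Require Import all_boot all_order all_algebra.
From mathcomp Require Import finmap.
From mathcomp Require Import all_classical all_reals all_analysis.
Set Implicit Arguments. Unset Strict Implicit. Unset Printing Implicit Defensive.
Import Order.TTheory GRing.Theory Num.Theory.
Local Open Scope ring_scope.
Local Open Scope classical_set_scope.
Local Open Scope fset_scope.

Section Defs.
Variable R : realType.

Definition l1dist (p q : R * R) : R := `|p.1 - q.1| + `|p.2 - q.2|.

(* A representation mu - nu = sum_i a_i (delta_{x_i} - delta_{y_i}), a_i >= 0,
   given as a list of triples (a_i, x_i, y_i). Measures are weight functions. *)
Definition emd_rep (X : eqType) (mu nu : X -> R) (r : seq (R * X * X)) : Prop :=
  (forall t, t \in r -> 0 <= t.1.1) /\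
  forall p : X, mu p - nu p =
    \sum_(t <- r) t.1.1 * ((p == t.1.2)%:R - (p == t.2)%:R).

Definition emd_cost (X : eqType) (d : X -> X -> R) (r : seq (R * X * X)) : R :=
  \sum_(t <- r) t.1.1 * d t.1.2 t.2.

Definition EMD (X : eqType) (d : X -> X -> R) (mu nu : X -> R) : \bar R :=
  ereal_inf [set (emd_cost d r)%:E | r in emd_rep mu nu].

Definition unif (X : choiceType) (A : {fset X}) : X -> R :=
  fun p => if p \in A then (#|` A|%:R)^-1 else 0.

(* M_2^s : uniform distributions on s-point subsets of R^2 (identified with
   the subsets), with the EMD w.r.t. the l1 metric *)
Definition M2 (s : nat) := {A : {fset (R * R)} | #|` A| == s}.

Definition M2dist (s : nat) (A B : M2 s) : \bar R :=
  EMD l1dist (unif (val A)) (unif (val B)).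

Definition L1_embeds_with (Y : Type) (rho : Y -> Y -> \bar R) (D : R) : Prop :=
  exists (d : measure_display) (T : measurableType d)
         (mu : {measure set T -> \bar R}) (F : Y -> T -> R),
    (forall y, mu.-integrable setT (fun t => (F y t)%:E)) /\
    forall x y,
      (rho x y <= \int[mu]_t (`|F x t - F y t|)%:E)%E /\
      (\int[mu]_t (`|F x t - F y t|)%:E <= D%:E * rho x y)%E.

Definition c1 (Y : Type) (rho : Y -> Y -> \bar R) : \bar R :=
  ereal_inf [set D%:E | D in [set D : R | 1 <= D /\ L1_embeds_with rho D]].

End Defs.

(* Main.v *)
Require Import Defs.
From HB Require Import structures.
From mathcomp Require Import all_boot all_order all_algebra.
From mathcomp Require Import finmap.
From mathcomp Require Import all_classical all_reals all_analysis.
From mathcomp Require Import ring lra zify.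
Set Implicit Arguments. Unset Strict Implicit. Unset Printing Implicit Defensive.
Import Order.TTheory GRing.Theory Num.Theory.
Local Open Scope fset_scope.
Local Open Scope ring_scope.

(** On the grid [{0, .., n-1}^2] with [n = 4^(L+1)], let [m] be the signed measure
    equal on each pair of horizontally adjacent [h x h] blocks to a random sign
    times the difference of the indicators of the two blocks, where [h] is drawn
    among the [L] scales [4, .., 4^L]. Normalized by [h], its transportation cost
    is of order [n^2] at every scale: test it against tents of height of order [h]
    centred in the blocks. On the other hand, for a set [A] of perimeter [P], the quantity
    [E |m(A)| / h] is at most [C sqrt (h P)] when [h <= P] (the coefficients of [A]
    add up to at most [h P] and are at most [2 h^2] each) and at most [P^2 / h] when
    [h > P] (isoperimetry), so the sum over all scales is at most [C P], without a
    factor [L]. By the coarea formula [sum_h E |<m, g>| / h] is at most [C] times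
    the total variation of [g], first for real-valued and then, integrating, for
    [L_1]-valued functions [g]; a linear embedding therefore has distortion at
    least [c L].

    A nonlinear embedding [F] is reduced to this case by viewing configurations as
    vectors of multiplicities at the grid points, the remaining mass sitting in a
    reservoir. After averaging over a large box, [F] has small second differences,
    so that the increment of [F] along [m] is close to a linear function of [m]
    with Lipschitz constant [D], while averaging over a still larger box of base
    points makes the increments along a long path [x, x + m, .., x + t m] comparable
    with those at a common random base point. All the parameters are polynomial in
    [n], so [s] can be taken to be a power of [n]. *)

(** * The Haar inequality on the grid *)

Section Rademacher.
Variables (R : numDomainType) (V : finType).

(** For [p != q], flipping the sign at [p] is an involution of the sign patterns that negates every
    term, so the sum equals its own opposite. *)
Lemma sum_sign_mul (p q : V) :
  \sum_(eps : {ffun V -> bool}) (-1) ^+ eps p * (-1) ^+ eps q =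
  (if p == q then #|{ffun V -> bool}|%:R else 0) :> R.
Proof.
case: eqVneq => [->|pq].
  under eq_bigr do rewrite -signr_addb addbb.
  by rewrite sumr_const.
set S := \sum_(eps : _) _.
have flipK : involutive (fun eps : {ffun V -> bool} => [ffun v => eps v (+) (v == p)]).
  by move=> eps; apply/ffunP => v; rewrite !ffunE -addbA addbb addbF.
have: S = - S.
  rewrite {1}/S (reindex_inj (inv_inj flipK)) /= -sumrN; apply: eq_bigr => eps _.
  by rewrite !ffunE eqxx [q == p]eq_sym (negbTE pq) addbF addbT signrN mulNr.
by move/eqP; rewrite -addr_eq0 -mulr2n mulrn_eq0 /= => /eqP.
Qed.

Lemma sum_sqr_signed (u : V -> R) :
  \sum_(eps : {ffun V -> bool}) (\sum_q (-1) ^+ eps q * u q) ^+ 2 =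
  #|{ffun V -> bool}|%:R * \sum_q u q ^+ 2.
Proof.
under eq_bigr do rewrite expr2 big_distrlr /=.
rewrite exchange_big mulr_sumr; apply: eq_bigr => p _ /=.
rewrite exchange_big (bigD1 p) //= [X in _ + X]big1 ?addr0 => [|q qp].
  under eq_bigr do rewrite mulrACA.
  by rewrite -mulr_suml sum_sign_mul eqxx.
under eq_bigr do rewrite mulrACA.
by rewrite -mulr_suml sum_sign_mul eq_sym (negbTE qp) mul0r.
Qed.

End Rademacher.

(** * Coarea principle: from indicator functions to all functions on a graph *)

Section Coarea.
Variables (R : realDomainType) (V E : finType) (src tgt : E -> V).

Definition total_var (g : V -> R) : R := \sum_e `|g (tgt e) - g (src e)|.

(** Layers are peeled off from the top. If [a] bounds [f] and [b] is the largest value below [a],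
    then [f] is its truncation at [b] plus [(a - b)] times the indicator of the level set [A] at
    height [a]. The total variation is additive for this splitting, while [Phi] is subadditive. The
    induction is on the number of vertices below [a], which drops at each truncation. *)
Lemma coarea_le (Phi : (V -> R) -> R) (C : R) :
  (forall f g, f =1 g -> Phi f = Phi g) ->
  (forall c, Phi (fun=> c) = 0) ->
  (forall f g, Phi (fun v => f v + g v) <= Phi f + Phi g) ->
  (forall c (A : pred V), 0 <= c ->
     Phi (fun v => c * (A v)%:R) <= c * (C * total_var (fun v => (A v)%:R))) ->
  0 <= C -> forall g, Phi g <= C * total_var g.
Proof.
move=> Phi_ext Phi_const Phi_add Phi_ind C0 g.
have tv0 f : 0 <= total_var f by exact: sumr_ge0.
suff H (k : nat) (a : R) (f : V -> R) : (forall v, f v <= a) ->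
    (#|[set v | (f v < a)%R]| <= k)%N -> Phi f <= C * total_var f.
  case: (pickP (@predT V)) => [v0 _|V0].
    have [v1 _ v1max] := Order.TotalTheory.arg_maxP (fun v => g v) (erefl : xpredT v0).
    by apply: (H #|V| (g v1)) => [v|]; [exact: v1max | exact: max_card].
  rewrite (Phi_ext g (fun=> 0)) ?Phi_const ?mulr_ge0 // => v.
  by have := V0 v.
elim: k a f => [|k IHk] a f f_le.
  rewrite leqn0 cards_eq0 => /eqP f0.
  rewrite (Phi_ext f (fun=> a)) ?Phi_const ?mulr_ge0 // => v.
  apply/eqP; rewrite eq_le f_le /= leNgt.
  by have /setP/(_ v) := f0; rewrite !inE => ->.
move=> fk; case: (pickP [pred v | f v < a]) => [v0 /= v0a|fa]; last first.
  rewrite (Phi_ext f (fun=> a)) ?Phi_const ?mulr_ge0 // => v.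
  apply/eqP; rewrite eq_le f_le /= leNgt.
  by have /= -> := fa v.
have [v1 v1a v1max] := Order.TotalTheory.arg_maxP (fun v => f v) (v0a : [pred v | f v < a] v0).
set b := f v1 in v1max; have ba : b < a by [].
pose f' v := Num.min (f v) b.
have [A AE] : {A : pred V | forall v, A v = ~~ (f v < a)} by exists (fun v => ~~ (f v < a)).
have fE v : f v = f' v + (a - b) * (A v)%:R.
  rewrite /f' AE; case: ltP => [fa|af] /=.
    by rewrite mulr0 addr0; apply/esym/min_idPl/v1max.
  have -> : f v = a by apply/eqP; rewrite eq_le f_le.
  by rewrite (min_idPr (ltW ba)) mulr1 addrC subrK.
have f'A v : A v -> f' v = b.
  rewrite AE -leNgt /f' => af; apply/min_idPr/ltW; exact: lt_le_trans af.
have f'b v : f' v <= b by rewrite /f' ge_min lexx orbT.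
have split_dist (x y z : R) : x <= y -> y <= z ->
    `|y + (z - y) * 1 - (x + (z - y) * 0)| = `|y - x| + (z - y) * `|1 - 0|.
  by move=> xy yz; rewrite !ger0_norm; lra.
have tvE : total_var f = total_var f' + (a - b) * total_var (fun v => (A v)%:R).
  rewrite /total_var mulr_sumr -big_split; apply: eq_bigr => e _ /=.
  rewrite [f (tgt e)]fE [f (src e)]fE.
  have ab : 0 <= a - b by rewrite subr_ge0 ltW.
  case: (boolP (A (tgt e))) => [/f'A ->|_]; case: (boolP (A (src e))) => [/f'A ->|_] /=;
    rewrite ?mulr1n ?mulr0n.
  - by rewrite !subrr !normr0 mulr0 addr0.
  - exact/split_dist/ltW.
  - by rewrite distrC [ `|f' _ - b|]distrC [ `|0 - 1|]distrC; exact/split_dist/ltW.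
  - by rewrite !mulr0 !addr0 subrr normr0 mulr0 addr0.
rewrite (Phi_ext f _ fE) (le_trans (Phi_add _ _)) // tvE mulrDr lerD //.
  apply: (IHk b) => //; rewrite -ltnS; apply: leq_trans fk; apply: proper_card.
  apply/properP; split; last first.
    by exists v1; rewrite !inE ?ba // /f' -/b minxx ltxx.
  apply/fintype.subsetP => v; rewrite !inE /f' gt_min ltxx orbF => /lt_trans; exact.
by rewrite mulrCA Phi_ind // subr_ge0 ltW.
Qed.

End Coarea.

(** * Summing the two regimes of the estimate for sets over the scales *)

Section Telescoping.
Variable R : realFieldType.

(** Both regimes are at most a constant times [q^2 min(r/q, q/r)], which is comparable to [q^2]
    times the increment of [r / (r + q)] when [r] doubles. These increments telescope over dyadic
    [r], to a total below 1. *)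
Lemma dyadic_min_le (q r X : R) : 0 < q -> 0 < r ->
  (r <= q -> X <= 3 / 2 * (r * q)) -> (q < r -> X <= q ^+ 4 / r ^+ 2) ->
  X <= 9 * q ^+ 2 * (2 * r / (2 * r + q) - r / (r + q)).
Proof.
move=> q0 r0 Xle Xgt.
have -> : 2 * r / (2 * r + q) - r / (r + q) = r * q / ((2 * r + q) * (r + q)).
  by field; apply/andP; split; apply: lt0r_neq0; lra.
have p0 : 0 < (2 * r + q) * (r + q) by rewrite mulr_gt0 //; lra.
have [rq|qr] := leP r q.
  apply: le_trans (Xle rq) _.
  rewrite mulrA ler_pdivlMr //.
  have : (2 * r + q) * (r + q) <= 6 * q ^+ 2 by nra.
  have : 0 <= r * q by rewrite mulr_ge0 ?ltW.
  nra.
apply: le_trans (Xgt qr) _.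
rewrite mulrA ler_pdivlMr // mulrAC ler_pdivrMr ?exprn_gt0 //.
have h1 : (2 * r + q) * (r + q) <= 6 * r ^+ 2 by nra.
have h2 : q ^+ 4 * ((2 * r + q) * (r + q)) <= q ^+ 4 * (6 * r ^+ 2).
  by apply: ler_wpM2l => //; rewrite exprn_ge0 // ltW.
apply: le_trans h2 _.
have -> : 9 * q ^+ 2 * (r * q) * r ^+ 2 = q ^+ 3 * r ^+ 2 * (9 * r) by ring.
have -> : q ^+ 4 * (6 * r ^+ 2) = q ^+ 3 * r ^+ 2 * (6 * q) by ring.
by apply: ler_wpM2l; [rewrite mulr_ge0 ?exprn_ge0 ?ltW | lra].
Qed.

(** To be used with [q] the square root of the perimeter and [2 ^+ i] the square root of the scale
    [4 ^ i]. The bound does not depend on [L]. *)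
Lemma sum_dyadic_min_le (q : R) (L : nat) (X : nat -> R) : 0 < q ->
  (forall i, (i < L)%N -> 2 ^+ i <= q -> X i <= 3 / 2 * (2 ^+ i * q)) ->
  (forall i, (i < L)%N -> q < 2 ^+ i -> X i <= q ^+ 4 / 4 ^+ i) ->
  \sum_(i < L) X i <= 9 * q ^+ 2.
Proof.
move=> q0 Xle Xgt.
pose psi i : R := 2 ^+ i / (2 ^+ i + q).
have two0 i : 0 < 2 ^+ i :> R by rewrite exprn_gt0.
have step (i : 'I_L) : X i <= 9 * q ^+ 2 * (psi i.+1 - psi i).
  rewrite /psi (exprS _ i); apply: dyadic_min_le => // [/Xle|/Xgt]; first exact.
  by rewrite -exprM mulnC exprM -[2 ^+ 2]natrX => H; apply: H.
apply: le_trans (ler_sum _ (fun i _ => step i)) _.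
rewrite -mulr_sumr -(big_mkord xpredT (fun i => psi i.+1 - psi i)) telescope_sumr //.
rewrite -[leRHS]mulr1; apply: ler_wpM2l; first by rewrite mulr_ge0 ?exprn_ge0 ?(ltW q0).
apply: (@le_trans _ _ (psi L)).
  by rewrite gerBl /psi divr_ge0 ?addr_ge0 ?ltW.
by rewrite /psi ler_pdivrMr ?addr_gt0 // mul1r lerDl ltW.
Qed.

End Telescoping.

Lemma sum_pairE (M : nmodType) (I J : finType) (F : I * J -> M) :
  \sum_p F p = \sum_i \sum_j F (i, j).
Proof. by rewrite pair_bigA; apply: eq_bigr => -[]. Qed.

(** * Haar sums along a single row *)

Section RowSums.
Variable R : numDomainType.

Lemma dist_le_variation (f : nat -> R) (n a b : nat) : (a <= n)%N -> (b <= n)%N ->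
  `|f a - f b| <= \sum_(0 <= x < n) `|f x.+1 - f x|.
Proof.
wlog ab : a b / (b <= a)%N.
  by move=> H an bn; have [/H|/ltnW/H] := leqP b a; [|rewrite distrC]; exact.
move=> an bn; rewrite (@big_cat_nat _ _ _ b) //= (@big_cat_nat _ _ _ a b) //=.
rewrite -(telescope_sumr f ab) (le_trans (ler_norm_sum _ _ _)) //.
by rewrite addrCA lerDl addr_ge0 // sumr_ge0.
Qed.

(** The partial sums of the signs form a tent on each period [2 * h]: they return to 0 at its ends
    and never exceed [h] in absolute value, whence the factor [h]. *)
Lemma haar_row_le (h k : nat) (c f : nat -> R) : (0 < h)%N -> (forall q, `|c q| <= 1) ->
  `|\sum_(0 <= x < 2 * h * k) c (x %/ (2 * h))%N * (-1) ^+ odd (x %/ h) * f x| <=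
  h%:R * \sum_(0 <= x < (2 * h * k).-1) `|f x.+1 - f x|.
Proof.
move=> h0 c1; set n := (2 * h * k)%N.
(* Summation by parts: [M] is the sequence of partial sums of the signs. *)
pose M x := c (x %/ (2 * h))%N * (minn (x %% (2 * h)) (2 * h - x %% (2 * h)))%:R.
have h20 : (0 < 2 * h)%N by rewrite muln_gt0.
have dM x : M x.+1 - M x = c (x %/ (2 * h))%N * (-1) ^+ odd (x %/ h).
  rewrite /M; have := ltn_pmod x h20; have := divn_eq x (2 * h).
  move: (x %/ (2 * h))%N (x %% (2 * h))%N => q r -> r2h.
  rewrite -addnS !divnMDl // !modnMDl.
  rewrite -[(q * (2 * h) + r)%N]/(q * (2 * h) + r)%N mulnA divnMDl // oddD oddM andbF /=.
  have [r1|r1] := ltnP r.+1 (2 * h).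
    rewrite (divn_small r1) (modn_small r1) addn0 -mulrBr; congr (_ * _).
    have [rh|hr] := ltnP r h.
      rewrite divn_small // expr0.
      have -> : minn r.+1 (2 * h - r.+1) = r.+1 by lia.
      have -> : minn r (2 * h - r) = r by lia.
      by rewrite -natr1 addrAC subrr add0r.
    have -> : (r %/ h = 1)%N by apply/eqP; rewrite eqn_leq divn_gt0 // hr -ltnS ltn_divLR // r2h.
    rewrite expr1.
    have -> : minn r.+1 (2 * h - r.+1) = (2 * h - r.+1)%N by lia.
    have -> : minn r (2 * h - r) = (2 * h - r.+1).+1%N by lia.
    by rewrite -[_.+1%:R]natr1 opprD addrA subrr add0r.
  have -> : r.+1 = (2 * h)%N by lia.
  rewrite modnn min0n mulr0 sub0r.
  have -> : (r %/ h = 1)%N by apply/eqP; rewrite eqn_leq divn_gt0 // -ltnS ltn_divLR //; lia.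
  have -> : minn r (2 * h - r) = 1%N by lia.
  by rewrite expr1 mulrN.
have M_le x : `|M x| <= h%:R.
  rewrite normrM normr_nat -[leRHS]mul1r; apply: ler_pM => //.
  by rewrite ler_nat; move: (x %% _)%N => r; lia.
have M0 : M 0%N = 0 by rewrite /M mod0n min0n mulr0.
have Mn : M n = 0 by rewrite /M /n mulnC modnMl min0n mulr0.
have -> : \sum_(0 <= x < n) c (x %/ (2 * h))%N * (-1) ^+ odd (x %/ h) * f x =
          - \sum_(0 <= x < n) M x.+1 * (f x.+1 - f x).
  apply/eqP; rewrite -addr_eq0 -big_split /=.
  under eq_bigr => x _ do rewrite -dM mulrBr mulrBl addrC addrA subrK.
  by rewrite (telescope_sumr (fun x => M x * f x)) // Mn M0 !mul0r subrr.
rewrite normrN.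
have [->|n0] := eqVneq n 0%N; first by rewrite !big_geq // normr0 mulr0.
rewrite -{1}(@prednK n) ?lt0n // big_nat_recr //= prednK ?lt0n // Mn mul0r addr0.
rewrite (le_trans (ler_norm_sum _ _ _)) // mulr_sumr ler_sum // => x _.
by rewrite normrM ler_wpM2r.
Qed.

End RowSums.

(** * The grid graph, its Haar sums and its isoperimetry *)

Section Grid.
Variables (R : realDomainType) (n' : nat).
Local Notation n := n'.+1.
Local Notation V := ('I_n * 'I_n)%type.

(** The Boolean is true for edges along the first coordinate. The index in ['I_n] is the coordinate
    that stays fixed, the one in ['I_n'] is the position of the source on its line. *)
Definition grid_edge := (bool * ('I_n * 'I_n'))%type.

Definition esrc (e : grid_edge) : V :=
  let x := widen_ord (leqnSn n') e.2.2 in if e.1 then (x, e.2.1) else (e.2.1, x).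

Definition etgt (e : grid_edge) : V :=
  let x := lift ord0 e.2.2 in if e.1 then (x, e.2.1) else (e.2.1, x).

Local Notation tv := (total_var esrc etgt).

Definition line_var (f : 'I_n -> R) : R :=
  \sum_(x < n') `|f (lift ord0 x) - f (widen_ord (leqnSn n') x)|.

Lemma line_varE (f : 'I_n -> R) :
  line_var f = \sum_(0 <= x < n') `|f (inord x.+1) - f (inord x)|.
Proof.
rewrite big_mkord; apply: eq_bigr => x _.
congr `|f _ - f _|; apply: val_inj; rewrite /= inordK //; have := ltn_ord x; lia.
Qed.

Lemma total_varE (g : V -> R) :
  tv g = \sum_y line_var (fun x => g (x, y)) + \sum_x line_var (fun y => g (x, y)).
Proof.
rewrite /total_var sum_pairE big_bool /= !sum_pairE //.
Qed.

Lemma dist_le_line_var (f : 'I_n -> R) a b : `|f a - f b| <= line_var f.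
Proof.
rewrite line_varE.
have := @dist_le_variation R (f \o inord) n' a b; rewrite /= !inord_val; by apply; rewrite -ltnS.
Qed.

(** Index of the [2h x h] rectangle around [v], a pair of adjacent [h x h] blocks. It takes its
    values in the grid itself, so that one type of sign families serves every scale. *)
Definition block (h : nat) (v : V) : V := (inord (v.1 %/ (2 * h)), inord (v.2 %/ h)).

Definition hsgn (h : nat) (eps : {ffun V -> bool}) (v : V) : bool :=
  eps (block h v) (+) odd (v.1 %/ h).

Definition haar_sum h eps (g : V -> R) : R := \sum_v (-1) ^+ hsgn h eps v * g v.

Lemma haar_sum_le_rows h k eps (g : V -> R) : (0 < h)%N -> n = (2 * h * k)%N ->
  `|haar_sum h eps g| <= h%:R * \sum_y line_var (fun x => g (x, y)).
Proof.
move=> h0 nE; rewrite /haar_sum sum_pairE exchange_big /=.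
rewrite (le_trans (ler_norm_sum _ _ _)) // mulr_sumr ler_sum // => y _.
rewrite line_varE.
pose c q : R := (-1) ^+ eps (inord q, inord (y %/ h)).
have := @haar_row_le R h k c (fun x => g (inord x, y)) h0; rewrite -nE /=.
have c1 q : `|c q| <= 1 by rewrite /c normr_sign.
rewrite big_mkord => /(_ c1); apply: le_trans.
rewrite le_eqVlt; apply/orP; left; apply/eqP; congr `|_|.
by apply: eq_bigr => x _; rewrite /c -signr_addb inord_val.
Qed.

Lemma haar_sum_le_sum h eps (g : V -> R) : `|haar_sum h eps g| <= \sum_v `|g v|.
Proof.
rewrite (le_trans (ler_norm_sum _ _ _)) // ler_sum // => v _.
by rewrite normrM normr_sign mul1r.
Qed.

Definition haar_coef h (g : V -> R) (q : V) : R :=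
  \sum_(v | block h v == q) (-1) ^+ odd (v.1 %/ h) * g v.

Lemma haar_sumE h eps (g : V -> R) :
  haar_sum h eps g = \sum_q (-1) ^+ eps q * haar_coef h g q.
Proof.
rewrite /haar_sum (partition_big (block h) xpredT) //=; apply: eq_bigr => q _.
rewrite mulr_sumr; apply: eq_bigr => v /eqP <-.
by rewrite signr_addb mulrA.
Qed.

Lemma card_block h q : (0 < h)%N -> (#|[pred v | block h v == q]| <= 2 * h * h)%N.
Proof.
move=> h0; have h20 : (0 < 2 * h)%N by rewrite muln_gt0.
pose f (v : V) : 'I_(2 * h) * 'I_h :=
  (Ordinal (ltn_pmod v.1 h20), Ordinal (ltn_pmod v.2 h0)).
have -> : (2 * h * h)%N = #|{: 'I_(2 * h) * 'I_h}| by rewrite card_prod !card_ord.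
apply: (leq_card_in f) => [[x y] [x' y']]; rewrite !inE /block /= => /eqP <- /eqP [].
have ltd (z : 'I_n) d : (z %/ d < n'.+1)%N by apply: leq_ltn_trans (leq_div _ _) (ltn_ord z).
move=> /(congr1 val)/=; rewrite !inordK // => e1 /(congr1 val)/=; rewrite !inordK // => e2.
move=> [e3 e4]; congr pair; apply: val_inj => /=.
  by rewrite (divn_eq x (2 * h)) (divn_eq x' (2 * h)) e1 e3.
by rewrite (divn_eq y h) (divn_eq y' h) e2 e4.
Qed.

(** One factor of each square is at most the area [2 h^2] of the rectangle. The absolute values of
    the coefficients add up to a Haar sum, the one whose signs match those of the coefficients, and
    the row estimate applies to it. *)
Lemma haar_coef_sqr_le h k (g : V -> R) : (0 < h)%N -> n = (2 * h * k)%N ->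
  (forall v, `|g v| <= 1) ->
  \sum_q haar_coef h g q ^+ 2 <=
  (2 * h * h)%:R * (h%:R * \sum_y line_var (fun x => g (x, y))).
Proof.
move=> h0 nE g1.
apply: (@le_trans _ _ (\sum_q (2 * h * h)%:R * `|haar_coef h g q|)).
  apply: ler_sum => q _; rewrite -real_normK ?num_real // expr2 ler_wpM2r //.
  rewrite (le_trans (ler_norm_sum _ _ _)) //.
  apply: le_trans (_ : \sum_(v | block h v == q) 1 <= _).
    by apply: ler_sum => v _; rewrite normrM normr_sign mul1r.
  by rewrite sumr_const ler_nat card_block.
rewrite -mulr_sumr ler_wpM2l //.
have := haar_sum_le_rows [ffun q => haar_coef h g q < 0] g h0 nE.
apply: le_trans; rewrite haar_sumE ler_normr; apply/orP; left.
by apply: ler_sum => q _; rewrite ffunE normrEsign.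
Qed.

(* A set of perimeter less than [n] is constant on some row and on some column, which cross, so up to
   complementation it lies in the product of the sets of non-constant rows and columns. *)
Lemma grid_isoperimetry (g : V -> R) :
  (forall v, g v = 0 \/ g v = 1) -> tv g < n%:R ->
  \sum_v g v <= tv g ^+ 2 \/ \sum_v (1 - g v) <= tv g ^+ 2.
Proof.
move=> g01 tvn.
have line_var_ge0 f : 0 <= line_var f by exact: sumr_ge0.
have small (t : 'I_n -> R) : \sum_x t x <= tv g -> (exists x, t x < 1).
  move=> tle; apply/existsP; rewrite -[X in is_true X]negbK negb_exists; apply/negP => /forallP t1.
  move: tvn; rewrite ltNge => /negP; apply; apply: le_trans tle.
  rewrite -[n in n%:R]card_ord -sumr_const ler_sum // => x _.
  by rewrite leNgt t1.
have [y0 ty0] : exists y, line_var (fun x => g (x, y)) < 1.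
  by apply: small; rewrite total_varE lerDl sumr_ge0.
have [x0 tx0] : exists x, line_var (fun y => g (x, y)) < 1.
  by apply: small; rewrite total_varE lerDr sumr_ge0.
have const u v : `|g u - g v| < 1 -> g u = g v.
  by case: (g01 u) (g01 v) => -> [] ->; rewrite ?subr0 ?sub0r ?normrN ?normr1 ?ltxx.
have rowE x : g (x, y0) = g (x0, y0).
  by apply/const/(le_lt_trans _ ty0); exact: (dist_le_line_var (fun x => g (x, y0))).
have colE y : g (x0, y) = g (x0, y0).
  by apply/const/(le_lt_trans _ tx0); exact: (dist_le_line_var (fun y => g (x0, y))).
pose c := g (x0, y0).
(* Each of the two line variations bounds [|g v - c|], which is 0 or 1 and so equals its square.
   Summed over the grid, the product separates into total horizontal times total vertical
   variation. *)
have rest v : `|g v - c| <= line_var (fun x => g (x, v.2)) * line_var (fun y => g (v.1, y)).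
  case: v => x y /=.
  have r1 : `|g (x, y) - c| <= line_var (fun x => g (x, y)).
    by rewrite /c -(colE y); exact: (dist_le_line_var (fun x => g (x, y))).
  have r2 : `|g (x, y) - c| <= line_var (fun y => g (x, y)).
    by rewrite /c -(rowE x); exact: (dist_le_line_var (fun y => g (x, y))).
  apply: le_trans (ler_pM _ _ r1 r2) => //.
  rewrite -normrM; case: (g01 (x, y)) (g01 (x0, y0)) => -> []; rewrite /c => ->;
    by rewrite ?subrr ?subr0 ?sub0r ?mulrNN ?mulr0 ?mulr1 ?normrN.
have total : \sum_v `|g v - c| <= tv g ^+ 2.
  apply: le_trans (ler_sum _ (fun v _ => rest v)) _.
  rewrite sum_pairE exchange_big /= -big_distrlr /= total_varE.
  set a := \sum_y _; set b := \sum_x _.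
  have a0 : 0 <= a by exact: sumr_ge0. 
  have b0 : 0 <= b by exact: sumr_ge0.
  by rewrite expr2; apply: ler_pM; rewrite ?lerDl ?lerDr.
case: (g01 (x0, y0)) => [] cE; [left|right]; apply: le_trans total;
  apply: ler_sum => v _; rewrite /c cE ?subr0 ?ler_norm // distrC ler_norm //.
Qed.

End Grid.

(** * The Haar inequality, for sets and then for functions *)

Section HaarInequality.
Variables (R : rcfType) (n' L : nat).
Local Notation n := n'.+1.
Local Notation V := ('I_n * 'I_n)%type.
Local Notation tv := (total_var (@esrc n') (@etgt n')).
Hypothesis nE : n = (4 ^ L.+1)%N.

Let four_gt0 i : (0 < 4 ^ i)%N. Proof. by rewrite expn_gt0. Qed.

Let n_scale i : (i < L.+1)%N -> n = (2 * 4 ^ i * (2 * 4 ^ (L - i)))%N.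
Proof.
move=> iL; rewrite nE mulnACA -expnD subnKC // expnS; lia.
Qed.

Lemma haar_sum_le_tv (i : nat) eps (g : V -> R) : (i < L.+1)%N ->
  `|haar_sum (4 ^ i) eps g| <= (4 ^ i)%:R * tv g.
Proof.
move=> iL; apply: le_trans (haar_sum_le_rows _ _ _ (n_scale iL)) _ => //.
rewrite ler_wpM2l // total_varE lerDl; apply: sumr_ge0 => x _; exact: sumr_ge0.
Qed.

Lemma haar_sum_const (i : nat) eps (c : R) : (i < L.+1)%N ->
  haar_sum (4 ^ i) eps (fun _ : V => c) = 0.
Proof.
move=> iL; apply/eqP; rewrite -normr_le0 (le_trans (haar_sum_le_tv _ _ iL)) //.
by rewrite /total_var big1 ?mulr0 // => e _; rewrite subrr normr0.
Qed.

Local Notation K := (#|{ffun V -> bool}|%:R).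

Lemma mean_haar_sum_set (g : V -> R) : (forall v, g v = 0 \/ g v = 1) ->
  \sum_(i < L.+1) (4 ^ i)%:R^-1 * (\sum_eps `|haar_sum (4 ^ i) eps g|) <= K * (9 * tv g).
Proof.
move=> g01; set P := tv g.
have P0 : 0 <= P by exact: sumr_ge0.
have K0 : 0 < K :> R.
  by rewrite ltr0n; apply/card_gt0P; exists [ffun=> false].
have scale0 i : 0 < (4 ^ i)%:R :> R by rewrite ltr0n.
have [P1|] := leP P 0.
  rewrite (le_trans _ (mulr_ge0 (ltW K0) (mulr_ge0 _ P0))) //.
  apply: sumr_le0 => i _; apply: mulr_ge0_le0; first by rewrite invr_ge0 ltW.
  apply: sumr_le0 => eps _; apply: le_trans (haar_sum_le_tv _ _ (ltn_ord i)) _.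
  by rewrite mulr_ge0_le0 // ltW.
move=> Pgt0; pose q := Num.sqrt P.
have q0 : 0 < q by rewrite sqrtr_gt0.
have q2 : q ^+ 2 = P by rewrite sqr_sqrtr.
rewrite -ler_pdivrMl // mulr_sumr -q2.
have p4 i : (4 ^ i)%:R = 2 ^+ i * 2 ^+ i :> R by rewrite -exprMn natrX -natrM.
pose X i := K^-1 * ((4 ^ i)%:R^-1 * \sum_eps `|haar_sum (4 ^ i) eps g|).
apply: (sum_dyadic_min_le (X := X)) => // i iL qi; rewrite /X.
  set h := (4 ^ i)%:R.
  have r0 : 0 < 2 ^+ i :> R by rewrite exprn_gt0.
  (* Up to a constant, [tau] is the root mean square [sqrt(2 h^3 P)] of the Haar sum. Used with this
     [tau], the inequality between arithmetic and geometric mean does the work of Cauchy-Schwarz and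
     yields [3/2 tau]. *)
  pose tau := h * (2 ^+ i * q).
  have tau0 : 0 < tau by rewrite !mulr_gt0 // scale0.
  have amgm (x : R) : `|x| <= (x ^+ 2 / tau + tau) / 2.
    rewrite -(real_normK (num_real x)) ler_pdivlMr // -(ler_pM2r tau0) mulrDl mulfVK ?gt_eqF //.
    have := sqr_ge0 (`|x| - tau); nra.
  have g1 v : `|g v| <= 1 by case: (g01 v) => ->; rewrite ?normr0 ?normr1.
  have sq := haar_coef_sqr_le (four_gt0 i) (n_scale iL) g1.
  have {}sq : \sum_eps haar_sum (4 ^ i) eps g ^+ 2 <= K * (2 * h ^+ 3 * P).
    under eq_bigr do rewrite haar_sumE.
    rewrite sum_sqr_signed; apply: ler_wpM2l; first exact: ltW.
    apply: le_trans sq _.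
    have -> : 2 * h ^+ 3 * P = (2 * 4 ^ i * 4 ^ i)%:R * (h * P) by rewrite /h !natrM; ring.
    rewrite !ler_wpM2l // /P total_varE lerDl; apply: sumr_ge0 => x _; exact: sumr_ge0.
  apply: (@le_trans _ _ (K^-1 * (h^-1 * ((K * (2 * h ^+ 3 * P) / tau + K * tau) / 2)))).
    apply: ler_wpM2l; first by rewrite invr_ge0 ltW.
    apply: ler_wpM2l; first by rewrite invr_ge0 ltW ?scale0.
    apply: le_trans (ler_sum _ (fun eps _ => amgm _)) _.
    rewrite -mulr_suml; apply: ler_wpM2r; first by rewrite invr_ge0.
    rewrite big_split /= -mulr_suml sumr_const -[tau *+ _]mulr_natl.
    by rewrite lerD2r ler_wpM2r // invr_ge0 ltW.
  rewrite le_eqVlt; apply/orP; left; apply/eqP; rewrite /tau /h p4 -q2.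
  by field; rewrite !gt_eqF.
(* In the other regime the perimeter is below the scale, hence below [n], as the isoperimetric
   inequality demands. *)
have Pn : P < n%:R.
  apply: (@lt_le_trans _ _ (4 ^ i)%:R); last by rewrite nE ler_nat leq_exp2l // ltnW.
  by rewrite p4 -q2 expr2 ltr_pM // ltW.
have Xle eps : `|haar_sum (4 ^ i) eps g| <= q ^+ 4.
  rewrite (_ : q ^+ 4 = P ^+ 2); last by rewrite -q2 -exprM.
  have [le|le] := grid_isoperimetry g01 Pn; apply: le_trans le.
    apply: le_trans (haar_sum_le_sum _ _ _) _; apply: ler_sum => v _.
    by case: (g01 v) => ->; rewrite ?normr0 ?normr1.
  (* Haar sums vanish on constants, so a set and its complement have opposite sums. *)
  have -> : haar_sum (4 ^ i) eps g = - haar_sum (4 ^ i) eps (fun v => 1 - g v).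
    rewrite -[LHS]subr0 -(haar_sum_const eps 1 iL) /haar_sum -sumrN -[X in _ = X]sumrN -big_split /=.
    by apply: eq_bigr => v _; ring.
  rewrite normrN; apply: le_trans (haar_sum_le_sum _ _ _) _; apply: ler_sum => v _.
  by case: (g01 v) => ->; rewrite ?subrr ?subr0 ?normr0 ?normr1.
rewrite mulrCA mulrC ler_pdivrMr ?exprn_gt0 // -natrX.
rewrite mulfVK ?gt_eqF ?scale0 //.
rewrite ler_pdivrMl // (le_trans (ler_sum _ (fun eps _ => Xle eps))) //.
by rewrite sumr_const mulr_natl.
Qed.

Theorem mean_haar_sum_le (g : V -> R) :
  \sum_(i < L.+1) (4 ^ i)%:R^-1 * (\sum_eps `|haar_sum (4 ^ i) eps g|) <= K * 9 * tv g.
Proof.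
pose Phi (g : V -> R) := \sum_(i < L.+1) (4 ^ i)%:R^-1 * (\sum_eps `|haar_sum (4 ^ i) eps g|).
have K0 : 0 <= K * 9 :> R by rewrite mulr_ge0.
apply: (coarea_le (Phi := Phi)) => // [f f' ff'|c|f f'|c A c0].
- apply: eq_bigr => i _; congr (_ * _); apply: eq_bigr => eps _; congr `|_|.
  by apply: eq_bigr => v _; rewrite ff'.
- apply: big1 => i _; rewrite big1 ?mulr0 // => eps _.
  by rewrite haar_sum_const ?normr0.
- rewrite -big_split; apply: ler_sum => i _ /=; rewrite -mulrDr ler_wpM2l ?invr_ge0 //.
  rewrite -big_split; apply: ler_sum => eps _ /=; apply: le_trans (ler_normD _ _).
  by rewrite /haar_sum -big_split /=; under eq_bigr do rewrite mulrDr.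
- have -> : Phi (fun v => c * (A v)%:R) = c * Phi (fun v => (A v)%:R).
    rewrite /Phi mulr_sumr; apply: eq_bigr => i _; rewrite mulrCA; congr (_ * _).
    rewrite mulr_sumr; apply: eq_bigr => eps _; rewrite -[c in RHS]ger0_norm // -normrM.
    by rewrite /haar_sum mulr_sumr; under eq_bigr do rewrite mulrCA.
  rewrite ler_wpM2l // -mulrA; apply: mean_haar_sum_set => v.
  by case: (A v); [right|left].
Qed.

End HaarInequality.

(** * From nonlinear maps to linear ones *)

Section Seminorm.
Variables (R : realFieldType) (W : lmodType R) (N : W -> R).

Definition is_seminorm : Prop :=
  (forall u v, N (u + v) <= N u + N v) /\ (forall a u, N (a *: u) = `|a| * N u).

Hypothesis N_semi : is_seminorm.

Lemma seminormD u v : N (u + v) <= N u + N v. Proof. exact: N_semi.1. Qed.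

Lemma seminormZ a u : N (a *: u) = `|a| * N u. Proof. exact: N_semi.2. Qed.

Lemma seminorm0 : N 0 = 0. Proof. by rewrite -(scale0r 0) seminormZ normr0 mul0r. Qed.

Lemma seminormN u : N (- u) = N u. Proof. by rewrite -scaleN1r seminormZ normrN1 mul1r. Qed.

Lemma seminormB u v : N (u - v) <= N u + N v.
Proof. by rewrite -(seminormN v) seminormD. Qed.

Lemma seminorm_distC u v : N (u - v) = N (v - u).
Proof. by rewrite -seminormN opprB. Qed.

Lemma seminorm_ge0 u : 0 <= N u.
Proof. by have := seminormB u u; rewrite subrr seminorm0; lra. Qed.

Lemma seminorm_sum (I : Type) (s : seq I) (P : pred I) (F : I -> W) :
  N (\sum_(i <- s | P i) F i) <= \sum_(i <- s | P i) N (F i).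
Proof.
elim/big_rec2: _ => [|i x y _ le]; first by rewrite seminorm0.
by rewrite (le_trans (seminormD _ _)) // lerD2l.
Qed.

Lemma seminorm_triangle w u v : N (u - v) <= N (u - w) + N (w - v).
Proof. by rewrite -[u - v](subrKA w) seminormD. Qed.

End Seminorm.

(** * Lattice vectors, boxes and signed paths *)

Section Lattice.
Variable V : finType.
Local Notation lattice := {ffun V -> int}.

Definition unitv (u : V) : lattice := [ffun v => (v == u)%:Z].

Definition signv (s : V -> bool) : lattice := [ffun v => (-1) ^+ s v].

Definition corner k (z : {ffun V -> 'I_k}) : lattice := [ffun v => (z v)%:Z].

Definition in_box (a b : int) (x : lattice) : Prop := forall v, a <= x v <= b.

(** End of a path from 0 that makes one unit step in each direction [u] of [l], downwards where
    [s u] holds. It breaks the jump by [signv s] into unit steps. *)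
Definition path_end (s : V -> bool) (l : seq V) : lattice := \sum_(u <- l) (unitv u *~ (-1) ^+ s u).

Lemma path_endE s l v : uniq l -> path_end s l v = if v \in l then (-1) ^+ s v else 0.
Proof.
rewrite /path_end; elim: l => [|u l IHl] /= => [_|/andP[ul /IHl lE]].
  by rewrite big_nil ffunE.
rewrite big_cons ffunE lE in_cons ffunMzE ffunE.
rewrite mulrzz; case: eqVneq => [->|] /=; rewrite ?(negbTE ul) ?addr0 ?mul1r ?mul0r ?add0r //.
Qed.

Lemma path_end_enum s : path_end s (enum V) = signv s.
Proof. by apply/ffunP => v; rewrite path_endE ?enum_uniq // mem_enum ffunE. Qed.

Lemma path_end_box s l : uniq l -> in_box (-1) 1 (path_end s l).
Proof. by move=> ul v; rewrite path_endE //; case: ifP => // _; case: (s v). Qed.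

(** After at most [t] steps along [signv s] the small box still lies in the larger one, which has a
    margin [t] on every side; the terms left out are nonnegative. *)
Lemma box_shift_sum (R : numDomainType) (M t k : nat) (s : V -> bool) (h : lattice -> R) :
  (k <= t)%N -> (forall x, 0 <= h x) ->
  \sum_(y : {ffun V -> 'I_M}) h (corner y + [ffun=> t.+1%:Z] + signv s *+ k) <=
  \sum_(y : {ffun V -> 'I_(M + 2 * t)}) h (corner y + [ffun=> 1]).
Proof.
move=> kt h0.
pose shift (y : {ffun V -> 'I_M}) v := (if s v then y v + t - k else y v + t + k)%N.
have shift_lt y v : (shift y v < M + 2 * t)%N.
  by rewrite /shift; have := ltn_ord (y v); case: (s v) => /=; lia.
pose f y : {ffun V -> 'I_(M + 2 * t)} := [ffun v => Ordinal (shift_lt y v)].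
have fE y v : f y v = shift y v :> nat by rewrite ffunE.
have f_inj : injective f.
  move=> y y' yy'; apply/ffunP => v; apply: val_inj => /=.
  have := congr1 (fun g : {ffun _ -> 'I__} => val (g v)) yy'; rewrite /= !fE /shift.
  by case: (s v) => /=; lia.
rewrite (eq_bigr (fun y => h (corner (f y) + [ffun=> 1]))) => [|y _].
  rewrite -(big_imset (fun y => h (corner y + [ffun=> 1]))) /=; last exact: in2W.
  by rewrite [leRHS](bigID [in [set f x | x in [pred x | true]]]) /= lerDl sumr_ge0.
congr h; apply/ffunP => v; rewrite !ffunE /= ffunMnE !ffunE /shift.
by case: (s v); rewrite ?expr0 ?expr1; lia.
Qed.

End Lattice.

(** * Averages over boxes have small second differences *)

Section Averaging.
Variables (R : realFieldType) (W : lmodType R) (N : W -> R) (V : finType) (r' : nat).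
Hypothesis N_semi : is_seminorm N.
Local Notation r := r'.+1.
Local Notation lattice := {ffun V -> int}.
Local Notation corners := {ffun V -> 'I_r}.

Definition box_avg (psi : lattice -> W) (x : lattice) : W :=
  #|{: corners}|%:R^-1 *: \sum_(z : corners) psi (x + corner z).

Let card_corners_gt0 : (0 : R) < #|{: corners}|%:R.
Proof. by rewrite ltr0n; apply/card_gt0P; exists [ffun=> ord0]. Qed.

Lemma box_avgB psi psi' x :
  box_avg (fun y => psi y - psi' y) x = box_avg psi x - box_avg psi' x.
Proof. by rewrite /box_avg sumrB scalerBr. Qed.

Lemma box_avg_shift psi a x : box_avg (fun y => psi (y + a)) x = box_avg psi (x + a).
Proof. by rewrite /box_avg; congr (_ *: _); apply: eq_bigr => z _; rewrite addrAC. Qed.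

Lemma box_avg_const w x : box_avg (fun=> w) x = w.
Proof. by rewrite /box_avg sumr_const -scaler_nat scalerA mulVf ?scale1r ?gt_eqF. Qed.

Lemma box_avg_le psi x c : (forall z : corners, N (psi (x + corner z)) <= c) ->
  N (box_avg psi x) <= c.
Proof.
move=> psi_le; rewrite seminormZ // gtr0_norm ?invr_gt0 //.
rewrite ler_pdivrMl // (le_trans (seminorm_sum N_semi _ _ _)) //.
by rewrite (le_trans (ler_sum _ (fun z _ => psi_le z))) // sumr_const mulr_natl.
Qed.

Lemma card_face (u : V) : (#|[pred z : corners | z u == ord_max]| * r = #|{: corners}|)%N.
Proof.
have -> : #|[pred z : corners | z u == ord_max]| =
  #|(family (fun v => if v == u then pred1 ord_max else predT) : simpl_pred corners)|.
  apply: eq_card => z; rewrite !inE; apply/idP/familyP => [/eqP zu v|/(_ u)].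
    by case: eqVneq => [->|//]; rewrite inE zu.
  by rewrite eqxx inE.
rewrite card_family foldrE big_map big_enum /= (bigD1 u) //= eqxx card1 mul1n mulnC.
rewrite card_ffun (cardD1 u) inE add1n expnS card_ord; congr (_ * _)%N.
rewrite (eq_bigr (fun=> r)) => [|v /negbTE ->]; last by rewrite card_ord.
by rewrite prod_nat_const; congr (_ ^ _)%N; apply: eq_card => v; rewrite !inE andbT.
Qed.

(* The box and its translate by one unit differ in two faces only, which carry a proportion [1 / r] of
   the mass each. *)
Lemma box_avg_unit_diff psi u x c :
  (forall z : corners, N (psi (x + corner z)) <= c) ->
  (forall z : corners, N (psi (x + unitv u + corner z)) <= c) ->
  N (box_avg psi (x + unitv u) - box_avg psi x) <= 2 * c / r%:R.
Proof.
move=> le0 le1; rewrite /box_avg -scalerBr seminormZ // gtr0_norm ?invr_gt0 //.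
rewrite ler_pdivrMl //.
(* Rotating the coordinate [u] cyclically matches the terms of the box with those of its translate,
   except on the face [z u = ord_max]. *)
pose rot (z : corners) : corners := [ffun v => if v == u then ordS (z v) else z v].
have rot_inj : injective rot.
  move=> z z' zz'; apply/ffunP => v.
  have := congr1 (fun g : corners => g v) zz'; rewrite !ffunE.
  by case: eqVneq => [_ /ordS_inj|].
rewrite [X in _ - X](reindex_inj rot_inj) /= -sumrB.
rewrite (bigID [pred z : corners | z u == ord_max]) /= [X in _ + X]big1 => [|z zu].
  rewrite addr0 (le_trans (seminorm_sum N_semi _ _ _)) //.
  apply: (@le_trans _ _ (\sum_(z : corners | z u == ord_max) 2 * c)).
    apply: ler_sum => z _; rewrite (le_trans (seminormB N_semi _ _)) //.
    by have := le0 (rot z); have := le1 z; lra.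
  rewrite sumr_const -(card_face u) -mulr_natl natrM le_eqVlt; apply/orP; left; apply/eqP.
  by field; rewrite addrC natr1 pnatr_eq0.
apply/eqP; rewrite subr_eq0; apply/eqP; congr psi; apply/ffunP => v; rewrite !ffunE -addrA.
congr (_ + _); case: eqVneq => [->|_]; last by rewrite add0r.
rewrite /= modn_small; last first.
  by move: zu; rewrite -val_eqE /= => zu; have := ltn_ord (z u); lia.
by lia.
Qed.

Variables (phi : lattice -> W) (X : nat) (E0 : R).
Hypothesis phi_unit : forall x v, in_box 0 X%:Z x -> N (phi (x + unitv v) - phi x) <= E0.
Hypothesis E0_ge0 : 0 <= E0.

Let dphi v y := phi (y + unitv v) - phi y.

Let dphi_avg v x : box_avg (dphi v) x = box_avg phi (x + unitv v) - box_avg phi x.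
Proof. by rewrite box_avgB box_avg_shift. Qed.

Let corner_box (x : lattice) (z : corners) a b :
  in_box a b x -> in_box a (b + r'%:Z) (x + corner z).
Proof.
move=> xab v; have := xab v; have := ltn_ord (z v); rewrite !ffunE.
by move: (x v) (nat_of_ord (z v)) => p q; lia.
Qed.

(** The increments of [phi] in direction [v] are at most [E0], so a unit step changes their average
    by at most [2 E0 / r]. The margin of one in the box leaves room for the path, which moves each
    coordinate at most once. *)
Lemma box_avg_dunit_path s l v x : uniq l -> in_box 1 (X%:Z - r%:Z) x ->
  N (box_avg (dphi v) (x + path_end s l) - box_avg (dphi v) x) <=
  (size l)%:R * (2 * E0 / r%:R).
Proof.
move=> + xbox; elim: l => [|u l IHl] => [_|ul].
  by rewrite /path_end big_nil addr0 subrr seminorm0 ?mul0r.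
have /= /andP[unl {}/IHl IHl] := ul.
have step (y : lattice) : in_box 0 (X%:Z - r'%:Z) y -> in_box 0 (X%:Z - r'%:Z) (y + unitv u) ->
    N (box_avg (dphi v) (y + unitv u) - box_avg (dphi v) y) <= 2 * E0 / r%:R.
  move=> y1 y2; apply: box_avg_unit_diff => z; apply: phi_unit.
    by have := corner_box z y1; rewrite subrK.
  by have := corner_box z y2; rewrite subrK.
apply: le_trans (seminorm_triangle N_semi (box_avg (dphi v) (x + path_end s l)) _ _) _.
rewrite -natr1 mulrDl mul1r [leRHS]addrC lerD //.
have box_l : in_box 0 (X%:Z - r'%:Z) (x + path_end s l).
  by move=> w; rewrite ffunE; have := path_end_box s (andP ul).2 w; have := xbox w;
    move: (x w) (path_end s l w) => p q; lia.
have box_ul : in_box 0 (X%:Z - r'%:Z) (x + path_end s (u :: l)).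
  by move=> w; rewrite ffunE; have := path_end_box s ul w; have := xbox w;
    move: (x w) (path_end _ _ w) => p q; lia.
have pE : path_end s (u :: l) = unitv u *~ (-1) ^+ s u + path_end s l by rewrite /path_end big_cons.
move: box_ul; rewrite pE addrCA addrC; case: (s u) => /= [|]; last exact: step.
move=> box_ul; rewrite seminorm_distC // -[X in box_avg _ X - _](subrK (unitv u)).
by apply: step; rewrite ?subrK.
Qed.

(** Along the path, each increment is compared with the increment at [x] in the same direction;
    [box_avg_dunit_path] bounds the error by [2 E0 / r] times the length of the path, at most
    [#|V|]. *)
Lemma box_avg_linearize s l x : uniq l -> in_box 1 (X%:Z - r%:Z) x ->
  N (box_avg phi (x + path_end s l) - box_avg phi x -
     \sum_(u <- l) (-1) ^+ s u *: (box_avg phi (x + unitv u) - box_avg phi x)) <=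
  (size l)%:R * (#|V|%:R * (2 * E0 / r%:R)).
Proof.
move=> + xbox; elim: l => [|u l IHl] => [_|ul].
  by rewrite /path_end !big_nil addr0 !subrr seminorm0 ?mul0r.
have /= /andP[unl ul'] := ul; have {}IHl := IHl ul'.
have size_le : ((size (u :: l))%:R : R) <= #|V|%:R.
  by rewrite ler_nat -(card_uniqP ul) max_card.
have r0 : 0 <= 2 * E0 / r%:R by rewrite divr_ge0 ?mulr_ge0.
have pE : path_end s (u :: l) = unitv u *~ (-1) ^+ s u + path_end s l by rewrite /path_end big_cons.
rewrite big_cons -dphi_avg.
set S := \sum_(_ <- l) _ in IHl *; set p := path_end s l in pE IHl.
have -> : box_avg phi (x + path_end s (u :: l)) - box_avg phi x -
    ((-1) ^+ s u *: box_avg (dphi u) x + S) =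
    (box_avg phi (x + path_end s (u :: l)) - box_avg phi (x + p) - (-1) ^+ s u *: box_avg (dphi u) x) +
    (box_avg phi (x + p) - box_avg phi x - S).
  by rewrite [RHS]addrACA subrKA opprD.
rewrite (le_trans (seminormD N_semi _ _)) // -natr1 mulrDl mul1r [leRHS]addrC lerD //.
apply: (@le_trans _ _ ((size (u :: l))%:R * (2 * E0 / r%:R))); last by rewrite ler_wpM2r.
case su: (s u) pE => pE /=; last first.
  rewrite pE expr0 mulr1z scale1r.
  rewrite addrCA addrC -dphi_avg (le_trans (box_avg_dunit_path _ _ ul' xbox)) //.
  by rewrite ler_wpM2r // ler_nat.
rewrite expr1 scaleN1r opprK.
(* A downward step is the opposite of the upward step from its end point, so the comparison uses the
   path that includes [u]. *)
have -> : box_avg phi (x + path_end s (u :: l)) - box_avg phi (x + p) =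
  - box_avg (dphi u) (x + path_end s (u :: l)).
  rewrite dphi_avg opprB; congr (_ - box_avg _ _).
  by rewrite pE expr1 mulrN1z -addrA [- _ + _ + _]addrAC addNr add0r.
by rewrite addrC seminorm_distC //; exact: box_avg_dunit_path.
Qed.

Lemma phi_corner k (y : {ffun V -> nat}) x : (\sum_v y v <= k)%N -> in_box 0 X%:Z x ->
  in_box 0 X%:Z (x + [ffun v => (y v)%:Z]) ->
  N (phi (x + [ffun v => (y v)%:Z]) - phi x) <= k%:R * E0.
Proof.
elim: k y => [|k IHk] y y_le x0 xy.
  have -> : [ffun v => (y v)%:Z] = 0 :> lattice.
    apply/ffunP => v; rewrite !ffunE; move: y_le; rewrite leqn0 sum_nat_eq0 => /forallP/(_ v).
    by move=> /implyP/(_ isT)/eqP ->.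
  by rewrite addr0 subrr seminorm0 // mul0r.
have [yk|yk] := leqP (\sum_v y v) k.
  by rewrite (le_trans (IHk _ _ _ _)) // ler_wpM2r // ler_nat.
have [u yu] : exists u, (0 < y u)%N.
  apply/existsP; rewrite -[X in is_true X]negbK negb_exists; apply/negP => /forallP y0.
  by move: yk; rewrite big1 // => v _; apply/eqP; rewrite -leqn0 leqNgt y0.
pose y' : {ffun V -> nat} := [ffun v => (y v - (v == u))%N].
have yE : [ffun v => (y v)%:Z] = [ffun v => (y' v)%:Z] + unitv u :> lattice.
  apply/ffunP => v; rewrite !ffunE; case: eqVneq => [->|_] /=; last by rewrite subn0 addr0.
  by move: (y u) yu => b; clear; lia.
have box' : in_box 0 X%:Z (x + [ffun v => (y' v)%:Z]).
  by move=> v; have := xy v; have := x0 v; rewrite !ffunE;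
    move: (x v) (y v) (v == u) => a b c; clear; lia.
rewrite yE addrA.
apply: le_trans (seminorm_triangle N_semi (phi (x + [ffun v => (y' v)%:Z])) _ _) _.
rewrite -natr1 mulrDl mul1r [leRHS]addrC lerD ?phi_unit //; apply: IHk => //.
rewrite -ltnS; apply: leq_trans y_le.
rewrite (bigD1 u) //= [ltnRHS](bigD1 u) //= !ffunE eqxx -addSn leq_add //; first lia.
by apply: leq_sum => v _; rewrite ffunE leq_subr.
Qed.

Lemma box_avg_close x : in_box 0 (X%:Z - r'%:Z) x ->
  N (box_avg phi x - phi x) <= (#|V| * r)%:R * E0.
Proof.
move=> xbox; rewrite -[X in _ - X](box_avg_const _ x) -box_avgB.
apply: box_avg_le => z.
pose y : {ffun V -> nat} := [ffun v => val (z v)].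
have zE : corner z = [ffun v => (y v)%:Z] by apply/ffunP => v; rewrite !ffunE.
rewrite zE; apply: phi_corner; last by rewrite -zE; have := corner_box z xbox; rewrite subrK.
  rewrite -sum_nat_const; apply: leq_sum => v _; rewrite ffunE; exact: ltnW (ltn_ord _).
by move=> v; have := xbox v; move: (x v) => a; clear; lia.
Qed.

End Averaging.

(** * Transfer of a linear inequality to a nonlinear map *)

Section Linearization.
Variables (R : realFieldType) (W : lmodType R) (N : W -> R).
Hypothesis N_semi : is_seminorm N.
Variables (V E J : finType) (src tgt : E -> V) (s : J -> V -> bool) (beta : J -> R) (C : R).
Hypothesis beta_ge0 : forall j, 0 <= beta j.
Hypothesis C_ge0 : 0 <= C.
Hypothesis linear_ineq : forall g : V -> W,
  \sum_j beta j * N (\sum_v (-1) ^+ s j v *: g v) <= C * \sum_e N (g (tgt e) - g (src e)).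
Local Notation lattice := {ffun V -> int}.
Variables (r' t M : nat) (phi : lattice -> W) (E0 e0 : R) (lambda : J -> R).
Local Notation r := r'.+1.
Local Notation X := (M + 2 * t + r)%N.
Hypothesis t_gt0 : (0 < t)%N.
Hypothesis M_gt0 : (0 < M)%N.
Hypothesis M_large : ((M + 2 * t) ^ #|V| <= 2 * M ^ #|V|)%N.
Hypothesis E0_ge0 : 0 <= E0.
Hypothesis e0_ge0 : 0 <= e0.
Hypothesis phi_edge : forall x e, in_box 0 X%:Z x ->
  N (phi (x + unitv (tgt e)) - phi (x + unitv (src e))) <= e0.
Hypothesis phi_unit : forall x v, in_box 0 X%:Z x -> N (phi (x + unitv v) - phi x) <= E0.
Hypothesis phi_lower : forall x j, in_box 0 X%:Z x -> in_box 0 X%:Z (x + signv (s j) *+ t) ->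
  t%:R * lambda j <= N (phi (x + signv (s j) *+ t) - phi x).

Let H := box_avg r' phi.
Let grad x v : W := H (x + unitv v) - H x.
Let h j x := N (\sum_v (-1) ^+ s j v *: grad x v).
Let err1 : R := (#|V| * r)%:R * E0.
Let err2 : R := #|V|%:R * (#|V|%:R * (2 * E0 / r%:R)).

(** The linear inequality is applied to the gradient of [H] at [x], whose difference across an edge
    is an average of increments of [phi] along that edge. *)
Let h_sum x : in_box 1 (M + 2 * t)%:Z x ->
  \sum_j beta j * h j x <= C * (#|E|%:R * e0).
Proof.
move=> xbox; apply: le_trans (linear_ineq _) _; rewrite ler_wpM2l //.
apply: (@le_trans _ _ (\sum_(e : E) e0)); last by rewrite sumr_const mulr_natl.
apply: ler_sum => e _; rewrite /grad opprB addrA subrK /H -!box_avg_shift -box_avgB.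
apply: box_avg_le => // z; apply: phi_edge => v.
have := xbox v; have := ltn_ord (z v); rewrite !ffunE.
by move: (x v) (nat_of_ord (z v)) => p q; clear; lia.
Qed.

Let step_le x j : in_box 1 (M + 2 * t)%:Z x ->
  N (H (x + signv (s j)) - H x) <= h j x + err2.
Proof.
move=> xbox.
have xbox' : in_box 1 (X%:Z - r%:Z) x.
  by move=> v; have := xbox v; move: (x v) => p; clear; lia.
have := box_avg_linearize N_semi phi_unit E0_ge0 (s j) (enum_uniq V) xbox'.
rewrite path_end_enum big_enum /= -cardE => le.
rewrite -[X in N X](subrK (\sum_v (-1) ^+ s j v *: grad x v)).
by rewrite (le_trans (seminormD N_semi _ _)) // addrC lerD.
Qed.

(** The growth of [phi] over [t] steps along [signv (s j)] is distributed over the steps. Passing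
    from [phi] to [H] at the two ends costs [2 * err1], and linearizing [H] costs [err2] per
    step. *)
Let telescoped_le (y : {ffun V -> 'I_M}) j (x := corner y + [ffun=> t.+1%:Z] : lattice) :
  t%:R * (lambda j - err2) - 2 * err1 <= \sum_(k < t) h j (x + signv (s j) *+ k).
Proof.
have xk k : (k <= t)%N -> in_box 1 (M + 2 * t)%:Z (x + signv (s j) *+ k).
  move=> kt v; rewrite !ffunE ffunMnE !ffunE; have := ltn_ord (y v).
  by move: (nat_of_ord (y v)) kt => p; case: (s j v); rewrite ?expr0 ?expr1; clear; lia.
have close k : (k <= t)%N -> N (H (x + signv (s j) *+ k) - phi (x + signv (s j) *+ k)) <= err1.
  move=> kt; apply: (box_avg_close N_semi phi_unit) => // v.
  by have := xk k kt v; move: ((x + signv (s j) *+ k : lattice) v) => p; clear; lia.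
have box k : (k <= t)%N -> in_box 0 X%:Z (x + signv (s j) *+ k).
  by move=> kt v; have := xk k kt v; move: ((x + signv (s j) *+ k : lattice) v) => p; clear; lia.
have x0E : x = x + signv (s j) *+ 0 by rewrite mulr0n addr0.
have low : t%:R * lambda j <= N (phi (x + signv (s j) *+ t) - phi x).
  by apply: phi_lower; [rewrite x0E; exact: box | exact: box].
have {}low : t%:R * lambda j <= N (H (x + signv (s j) *+ t) - H x) + 2 * err1.
  apply: le_trans low _.
  apply: le_trans (seminorm_triangle N_semi (H (x + signv (s j) *+ t)) _ _) _.
  apply: le_trans (lerD (lexx _) (seminorm_triangle N_semi (H x) _ _)) _.
  have := close t (leqnn t); have := close 0%N (leq0n t); rewrite -x0E.
  by rewrite (seminorm_distC N_semi (phi _) (H _)); lra.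
have tele : N (H (x + signv (s j) *+ t) - H x) <=
    \sum_(k < t) (h j (x + signv (s j) *+ k) + err2).
  rewrite -(big_mkord xpredT (fun k => h j (x + signv (s j) *+ k) + err2)).
  have -> : H (x + signv (s j) *+ t) - H x =
      \sum_(0 <= k < t) (H (x + signv (s j) *+ k.+1) - H (x + signv (s j) *+ k)).
    by rewrite (telescope_sumr (fun k => H (x + signv (s j) *+ k))) // mulr0n addr0.
  rewrite (le_trans (seminorm_sum N_semi _ _ _)) // !big_nat ler_sum // => k /andP[_ kt].
  by rewrite mulrSr addrA step_le //; apply: xk; exact: ltnW.
move: tele; rewrite big_split /= sumr_const card_ord -[err2 *+ t]mulr_natl => tele.
have : t%:R * lambda j <= \sum_(k < t) h j (x + signv (s j) *+ k) + t%:R * err2 + 2 * err1.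
  by apply: le_trans low _; rewrite lerD2r.
by rewrite mulrBr; lra.
Qed.

(** The path estimate is summed over base points in the box of side [M]. Each translated box is then
    enlarged to the common box of side [M + 2 * t], where the linear inequality holds at every
    point. The factor 2 bounds the ratio of the cardinalities of the two boxes. *)
Theorem poincare_linearized :
  \sum_j beta j * (lambda j - err2 - 2 * err1 / t%:R) <= 2 * C * (#|E|%:R * e0).
Proof.
have t0 : 0 < t%:R :> R by rewrite ltr0n.
have MV : 0 < (M ^ #|V|)%:R :> R by rewrite ltr0n expn_gt0 M_gt0.
rewrite -(ler_pM2l t0) -(ler_pM2l MV).
apply: (@le_trans _ _ (\sum_j beta j * \sum_(y : {ffun V -> 'I_M}) \sum_(k < t)
    h j (corner y + [ffun=> t.+1%:Z] + signv (s j) *+ k))).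
  rewrite !mulr_sumr; apply: ler_sum => j _.
  have -> : (M ^ #|V|)%:R * (t%:R * (beta j * (lambda j - err2 - 2 * err1 / t%:R))) =
    beta j * ((M ^ #|V|)%:R * (t%:R * (lambda j - err2) - 2 * err1)).
    by field; rewrite gt_eqF.
  rewrite ler_wpM2l //.
  have -> : (M ^ #|V|)%N = #|{ffun V -> 'I_M}| by rewrite card_ffun card_ord.
  by rewrite mulr_natl -sumr_const; apply: ler_sum => y _; exact: telescoped_le.
apply: (@le_trans _ _ (\sum_j beta j * \sum_(k < t) \sum_(y : {ffun V -> 'I_(M + 2 * t)})
    h j (corner y + [ffun=> 1]))).
  apply: ler_sum => j _; rewrite ler_wpM2l // exchange_big ler_sum // => k _.
  apply: box_shift_sum => [|x]; first exact: ltnW.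
  exact: seminorm_ge0.
under eq_bigr do rewrite sumr_const card_ord -mulr_natl mulrCA.
rewrite -mulr_sumr mulrCA ler_wpM2l //.
under eq_bigr do rewrite mulr_sumr.
rewrite exchange_big /=.
apply: (@le_trans _ _ (\sum_(y : {ffun V -> 'I_(M + 2 * t)}) C * (#|E|%:R * e0))).
  apply: ler_sum => y _; apply: h_sum => v; rewrite !ffunE; have := ltn_ord (y v).
  by move: (nat_of_ord (y v)) => p; clear; lia.
rewrite sumr_const card_ffun card_ord -[_ *+ _]mulr_natl -[2 * C * _]mulrA.
have := M_large; rewrite -(ler_nat R) natrM.
have : 0 <= C * (#|E|%:R * e0) by rewrite !mulr_ge0.
nra.
Qed.

End Linearization.

Lemma bernoulli_le (R : realFieldType) (x : R) n : 0 <= x <= 1 -> 1 - n%:R * x <= (1 - x) ^+ n.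
Proof.
case/andP=> x0 x1; elim: n => [|n IHn]; first by rewrite mul0r subr0 expr0.
apply: (@le_trans _ _ ((1 - x) * (1 - n%:R * x))).
  have : 0 <= n%:R * x ^+ 2 by rewrite mulr_ge0 ?exprn_ge0.
  by rewrite -natr1; nra.
by rewrite exprS ler_wpM2l // subr_ge0.
Qed.

(** With [x = 2t / (M + 2t)] one has [n x <= 1/2], so Bernoulli gives [(1 - x)^n >= 1/2]. *)
Lemma expn_add_le (M t n : nat) : (4 * t * n <= M)%N -> (0 < M)%N ->
  ((M + 2 * t) ^ n <= 2 * M ^ n)%N.
Proof.
move=> tM M0; rewrite -(ler_nat rat) natrM !natrX.
set A : rat := (M + 2 * t)%:R.
have A0 : 0 < A by rewrite ltr0n; lia.
pose x := (2 * t)%:R / A.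
have ME : M%:R = A * (1 - x) by rewrite mulrBr mulr1 mulrC divfK ?gt_eqF // /A natrD addrK.
have x01 : 0 <= x <= 1.
  by rewrite /x divr_ge0 ?(ltW A0) //= ler_pdivrMr // mul1r /A ler_nat leq_addl.
rewrite ME exprMn mulrCA -[leLHS]mulr1; apply: ler_wpM2l; first by rewrite exprn_ge0 ?ltW.
have := bernoulli_le n x01.
have : n%:R * x <= 1 / 2.
  by rewrite mulrA ler_pdivrMr // /A mulrAC mul1r ler_pdivlMr // -!natrM ler_nat; lia.
lra.
Qed.

(** * Integrable functions *)

Section IntegrableFunctions.
Context {R : realType} {d : measure_display} {T : measurableType d} (mu : {measure set T -> \bar R}).

Definition integrable_pred : {pred (T -> R)} := fun f => `[< mu.-integrable setT (EFin \o f) >].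

Lemma integrable_submod_closed : submod_closed integrable_pred.
Proof.
split; first by apply/asboolP; exact: integrable0.
move=> a f g /asboolP hf /asboolP hg; apply/asboolP.
have -> : EFin \o (a *: f + g) = ((fun x => a%:E * (EFin \o f) x) \+ (EFin \o g))%E by apply/funext.
by apply: integrableD => //; exact: integrableZl.
Qed.

HB.instance Definition _ :=
  GRing.isSubmodClosed.Build R (T -> R) integrable_pred integrable_submod_closed.

(** Genuine functions, not classes modulo null sets: scalar inequalities can be applied pointwise
    and then integrated, and [L1norm] is only a seminorm. *)
Record intfun := IntFun { intfun_val :> T -> R; _ : intfun_val \in integrable_pred }.
HB.instance Definition _ := [isSub for intfun_val].
HB.instance Definition _ := [Choice of intfun by <:].
HB.instance Definition _ := [SubChoice_isSubLmodule of intfun by <:].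

Definition L1norm (w : intfun) : R := \int[mu]_t `|w t|.

Lemma integrable_normr_intfun (w : intfun) : mu.-integrable setT (EFin \o (Num.norm \o w)).
Proof. by apply: integrable_norm => //; apply/asboolP; exact: valP w. Qed.

Lemma intfunD (u v : intfun) t : (u + v) t = u t + v t.
Proof. by rewrite -[LHS]/(val (u + v) t) raddfD. Qed.

Lemma intfunB (u v : intfun) t : (u - v) t = u t - v t.
Proof. by rewrite -[LHS]/(val (u - v) t) raddfB. Qed.

Lemma intfunZ a (u : intfun) t : (a *: u) t = a * u t.
Proof. by rewrite -[LHS]/(val (a *: u) t) linearZ. Qed.

Lemma intfun_sum (I : Type) (r : seq I) (F : I -> intfun) t :
  (\sum_(i <- r) F i) t = \sum_(i <- r) F i t.
Proof. by rewrite -[LHS]/(val _ t) raddf_sum fct_sumE. Qed.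

Lemma integrable_add_fun (f g : T -> R) :
  mu.-integrable setT (EFin \o f) -> mu.-integrable setT (EFin \o g) ->
  mu.-integrable setT (EFin \o (fun t => f t + g t)).
Proof.
move=> hf hg; have -> : EFin \o (fun t => f t + g t) = ((EFin \o f) \+ (EFin \o g))%E by apply/funext.
exact: integrableD.
Qed.

Lemma L1norm_seminorm : is_seminorm L1norm.
Proof.
split=> [u v|a u]; last first.
  rewrite /L1norm -RintegralZl //; last exact: integrable_normr_intfun.
  by apply: eq_Rintegral => t _; rewrite intfunZ normrM.
have iu := integrable_normr_intfun u; have iv := integrable_normr_intfun v.
rewrite /L1norm -RintegralD //; apply: le_Rintegral => //.
- exact: integrable_normr_intfun.
- exact: integrable_add_fun.
- by move=> t _; rewrite intfunD ler_normD.
Qed.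

Lemma Rintegral_sum_normr (I : Type) (r : seq I) (a : I -> R) (F : I -> intfun) :
  mu.-integrable setT (EFin \o (fun t => \sum_(i <- r) a i * `|F i t|)) /\
  \int[mu]_t (\sum_(i <- r) a i * `|F i t|) = \sum_(i <- r) a i * L1norm (F i).
Proof.
elim: r => [|i r [int_r IHr]].
  split; first by under eq_fun do rewrite big_nil; exact: integrable0.
  by under eq_Rintegral do rewrite big_nil; rewrite big_nil /Rintegral integral0.
have int_i : mu.-integrable setT (EFin \o (fun t => a i * `|F i t|)).
  have -> : EFin \o (fun t => a i * `|F i t|) = (fun t => (a i)%:E * (EFin \o (Num.norm \o F i)) t)%E.
    by apply/funext.
  by apply: integrableZl => //; exact: integrable_normr_intfun.
have -> : (fun t => \sum_(j <- i :: r) a j * `|F j t|) =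
          (fun t => a i * `|F i t| + \sum_(j <- r) a j * `|F j t|).
  by apply/funext => t; rewrite big_cons.
split; last first.
  rewrite RintegralD // IHr big_cons RintegralZl //; exact: integrable_normr_intfun.
exact: integrable_add_fun.
Qed.

Lemma L1norm_transfer (I J : finType) (a : I -> R) (F : I -> intfun) (C : R) (G : J -> intfun) :
  (forall t, \sum_i a i * `|F i t| <= C * \sum_j `|G j t|) ->
  \sum_i a i * L1norm (F i) <= C * \sum_j L1norm (G j).
Proof.
move=> le; rewrite mulr_sumr.
have [intF <-] := Rintegral_sum_normr (index_enum I) a F.
have [intG <-] := Rintegral_sum_normr (index_enum J) (fun=> C) G.
by apply: le_Rintegral => // t _; rewrite -mulr_sumr.
Qed.

(** The scalar inequality is integrated. The nonnegative term of scale 1 is dropped, as the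
    transport estimate below is made for blocks whose side is a multiple of 4. *)
Lemma haar_sum_intfun_le (n' L : nat) (g : 'I_n'.+1 * 'I_n'.+1 -> intfun) :
  n'.+1 = (4 ^ L.+1)%N ->
  \sum_(j : 'I_L * {ffun 'I_n'.+1 * 'I_n'.+1 -> bool}) (4 ^ j.1.+1)%:R^-1 *
     L1norm (\sum_v (-1) ^+ hsgn (4 ^ j.1.+1) j.2 v *: g v) <=
  #|{ffun 'I_n'.+1 * 'I_n'.+1 -> bool}|%:R * 9 *
    \sum_e L1norm (g (etgt e) - g (esrc e)).
Proof.
move=> nE; apply: L1norm_transfer => t.
under [in leRHS]eq_bigr do rewrite intfunB.
apply: le_trans (mean_haar_sum_le nE (fun v => g v t)).
rewrite sum_pairE big_ord_recl /=; apply: ler_wpDl.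
  by rewrite mulr_ge0 ?invr_ge0 // sumr_ge0.
apply: ler_sum => i _; rewrite mulr_sumr; apply: ler_sum => eps _ /=.
rewrite intfun_sum; under eq_bigr do rewrite intfunZ.
exact: lexx.
Qed.

End IntegrableFunctions.

(** * The earth mover's distance of configurations *)

Section UniqueSums.
Variables (R : pzSemiRingType) (T : eqType).

Lemma sum_uniq_indicator (s : seq T) (x : T) : uniq s ->
  \sum_(p <- s) (x == p)%:R = (x \in s)%:R :> R.
Proof.
elim: s => [|p s IHs] /=; first by rewrite big_nil.
move=> /andP[ps us]; rewrite big_cons IHs // in_cons.
by case: eqVneq => [->|_] /=; rewrite ?(negbTE ps) ?addr0 ?add0r.
Qed.

Lemma sum_uniq_delta (s : seq T) (x : T) (f : T -> R) : uniq s -> x \in s ->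
  \sum_(p <- s) f p * (p == x)%:R = f x.
Proof.
move=> us xs; rewrite (bigD1_seq x) //= eqxx mulr1 big1 ?addr0 // => p /negbTE ->.
by rewrite mulr0.
Qed.

Lemma sum_uniq_sub (s A : seq T) (f : T -> R) : uniq s -> uniq A -> {subset A <= s} ->
  \sum_(p <- s) (if p \in A then f p else 0) = \sum_(p <- A) f p.
Proof.
move=> us uA As; rewrite -big_mkcond -big_filter; apply: perm_big.
apply: uniq_perm => // [|x]; first exact: filter_uniq.
by rewrite mem_filter; case: (boolP (x \in A)) => //= /As.
Qed.

End UniqueSums.

(** * Bounds for the earth mover's distance of uniform measures *)

Section EarthMover.
Variable R : realType.
Implicit Types (A B : {fset (R * R)}) (f : R * R -> R).

Definition lip1 f := forall p q, `|f p - f q| <= l1dist p q.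

(** The easy half of Kantorovich duality: [f] is integrated against an arbitrary representation of
    the difference. *)
Lemma EMD_ge f A B (s : nat) : lip1 f -> #|` A| = s -> #|` B| = s ->
  (((\sum_(p <- A) f p - \sum_(p <- B) f p) / s%:R)%:E <= EMD (@l1dist R) (unif R A) (unif R B))%E.
Proof.
move=> f1 cA cB; apply: le_ereal_inf_tmp => _ [r [r0 rE] <-]; rewrite lee_fin.
pose P := undup (enum_fset A ++ enum_fset B ++ [seq t.1.2 | t <- r] ++ [seq t.2 | t <- r]).
have uP : uniq P by exact: undup_uniq.
have unif_sum C : #|` C| = s -> {subset enum_fset C <= P} ->
    \sum_(p <- P) f p * unif R C p = (\sum_(p <- C) f p) / s%:R.
  move=> cC CP; rewrite mulr_suml -(sum_uniq_sub _ uP (fset_uniq C) CP).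
  by apply: eq_bigr => p _; rewrite /unif cC; case: ifP; rewrite ?mulr0.
have AP : {subset enum_fset A <= P} by move=> x xA; rewrite mem_undup mem_cat xA.
have BP : {subset enum_fset B <= P} by move=> x xB; rewrite mem_undup !mem_cat xB orbT.
rewrite mulrBl -(unif_sum A) // -(unif_sum B) // -sumrB.
have -> : \sum_(p <- P) (f p * unif R A p - f p * unif R B p) =
    \sum_(t <- r) t.1.1 * (f t.1.2 - f t.2).
  transitivity (\sum_(p <- P) \sum_(t <- r) t.1.1 * (f p * (p == t.1.2)%:R - f p * (p == t.2)%:R)).
    apply: eq_bigr => p _; rewrite -mulrBr rE mulr_sumr; apply: eq_bigr => t _; ring.
  rewrite exchange_big; apply: eq_big_seq => t tr /=.
  rewrite -mulr_sumr sumrB !sum_uniq_delta //; rewrite mem_undup !mem_cat.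
    by rewrite (map_f (fun t : R * (R * R) * (R * R) => t.2)) ?orbT.
  by rewrite (map_f (fun t : R * (R * R) * (R * R) => t.1.2)) ?orbT.
rewrite /emd_cost big_seq [leRHS]big_seq; apply: ler_sum => t tr.
by rewrite ler_wpM2l ?r0 // (le_trans (ler_norm _)) // f1.
Qed.

Lemma EMD_swap_le A B p q (s : nat) : #|` A| = s -> #|` B| = s ->
  (forall x, (x \in A)%:R - (x \in B)%:R = (x == p)%:R - (x == q)%:R :> R) ->
  (EMD (@l1dist R) (unif R A) (unif R B) <= (l1dist p q / s%:R)%:E)%E.
Proof.
move=> cA cB AB; apply: ereal_inf_lbound; exists [:: (s%:R^-1, p, q)]; last first.
  by rewrite /emd_cost big_seq1 /= mulrC.
split=> [t|x]; first by rewrite inE => /eqP ->; rewrite /= invr_ge0.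
rewrite big_seq1 /= -AB /unif cA cB.
by case: (x \in A); case: (x \in B); rewrite ?mulr1n ?mulr0n; ring.
Qed.

End EarthMover.

(** * Signed tents as Lipschitz test functions *)

Section Tents.
Variables (R : realType) (I : finType) (c : I -> R * R) (r : R) (sgn : I -> bool).
Hypothesis far : forall i j, i != j -> 2 * r <= l1dist (c i) (c j).

Lemma l1dist_triangle (p q z : R * R) : l1dist p q <= l1dist p z + l1dist z q.
Proof.
rewrite /l1dist addrACA lerD //; [rewrite -[p.1 - q.1](subrKA z.1) | rewrite -[p.2 - q.2](subrKA z.2)];
  exact: ler_normD.
Qed.

Lemma l1distC (p q : R * R) : l1dist p q = l1dist q p.
Proof. by rewrite /l1dist distrC [X in _ + X]distrC. Qed.

Definition tent (i : I) (p : R * R) : R := Num.max 0 (r - l1dist p (c i)).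

Definition tents (p : R * R) : R := \sum_i (-1) ^+ sgn i * tent i p.

Lemma tent_ge0 i p : 0 <= tent i p. Proof. by rewrite le_max lexx. Qed.

Lemma tent_lip i p q : tent i p - tent i q <= l1dist p q.
Proof.
have := l1dist_triangle q (c i) p; rewrite (l1distC q p) => tri.
have d0 : 0 <= l1dist p q by rewrite addr_ge0.
by rewrite /tent; case: (leP 0 (r - l1dist p (c i))); case: (leP 0 (r - l1dist q (c i))); lra.
Qed.

Lemma tent_lip_norm i p q : `|tent i p - tent i q| <= l1dist p q.
Proof. by rewrite ler_norml tent_lip andbT lerNl opprB l1distC tent_lip. Qed.

Lemma tentsE i p : (forall j, j != i -> tent j p = 0) -> tents p = (-1) ^+ sgn i * tent i p.
Proof.
by move=> z; rewrite /tents (bigD1 i) //= big1 ?addr0 // => j /z ->; rewrite mulr0.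
Qed.

(* The supports of the two tents are disjoint balls of radius [r]. *)
Lemma tent_disjoint i j p q : i != j -> 0 < tent i p -> 0 < tent j q ->
  tent i p + tent j q <= l1dist p q.
Proof.
move=> ij; rewrite /tent !lt_max ltxx /= => bi bj.
rewrite (max_r (ltW bi)) (max_r (ltW bj)).
have := far ij; have := l1dist_triangle (c i) (c j) p; have := l1dist_triangle p (c j) q.
rewrite [l1dist (c i) p]l1distC; lra.
Qed.

(** At most one tent is nonzero at each point. Two points in the same tent are handled by its own
    Lipschitz bound; for two different tents, the sum of the heights is already at most the
    distance, whatever the signs. *)
Lemma tents_lip1 : lip1 tents.
Proof.
move=> p q.
have one z : tents z = 0 /\ (forall i, tent i z = 0) \/
    exists i, [/\ tents z = (-1) ^+ sgn i * tent i z, 0 < tent i z &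
                  forall j, j != i -> tent j z = 0].
  case: (pickP [pred i | 0 < tent i z]) => [i /= bi|none].
    right; exists i; have H j : j != i -> tent j z = 0.
      move=> ji; apply/eqP; rewrite eq_le tent_ge0 andbT leNgt; apply/negP => bj.
      have := tent_disjoint ji bj bi; rewrite /l1dist !subrr normr0 addr0; lra.
    by split=> //; exact: tentsE.
  have H i : tent i z = 0.
    by apply/eqP; rewrite eq_le tent_ge0 andbT leNgt; have /= -> := none i.
  by left; split=> //; rewrite /tents big1 // => i _; rewrite H mulr0.
have [[-> zp]|[i [-> bi zi]]] := one p; have [[-> zq]|[j [-> bj zj]]] := one q.
- by rewrite subrr normr0 addr_ge0.
- by have := tent_lip_norm j p q; rewrite zp !sub0r !normrN normrM normr_sign mul1r.
- by have := tent_lip_norm i p q; rewrite zq !subr0 normrM normr_sign mul1r.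
have [ij|ij] := eqVneq i j.
  by rewrite ij -mulrBr normrM normr_sign mul1r tent_lip_norm.
apply: le_trans (tent_disjoint ij bi bj).
rewrite (le_trans (ler_normB _ _)) // !normrM !normr_sign !mul1r !ger0_norm ?tent_ge0 //.
Qed.

End Tents.

Lemma big_optionE (T : Type) (idx : T) (op : Monoid.com_law idx) (V : finType) (F : option V -> T) :
  \big[op/idx]_u F u = op (F None) (\big[op/idx]_v F (Some v)).
Proof.
rewrite (bigD1 None) //=; congr (op _ _).
by rewrite (reindex_omap Some id) => [|[]//]; apply: eq_bigl => v; rewrite /= eqxx.
Qed.

(** * Clusters of points in the plane *)

Section Configurations.
Variables (R : realType) (n' s : nat).
Local Notation n := n'.+1.
Local Notation V := ('I_n * 'I_n)%type.
Local Notation U := (option V).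
Hypothesis s_gt0 : (0 < s)%N.

Local Notation S := (32 * s)%N.

(** The reservoir [None] occupies column 0, so the columns of the grid are moved up by one. *)
Definition col (u : U) : nat := if u is Some v then v.1.+1 else 0.
Definition row (u : U) : nat := if u is Some v then v.2 else 0.

(* Several points of the same cluster [u] are kept apart by shifting the [i]-th one by [i], which
   is small with respect to the mesh [32 * s]. *)
Definition pt (u : U) (i : nat) : R * R := ((S * col u + i)%:R, (S * row u)%:R).

Lemma pt_inj u u' i i' : (i < S)%N -> (i' < S)%N -> pt u i = pt u' i' -> u = u' /\ i = i'.
Proof.
move=> iS i'S [/eqP + /eqP]; rewrite !eqr_nat => /eqP e1 /eqP e2.
have S0 : (0 < S)%N by rewrite muln_gt0.
have ii' : i = i' by have := congr1 (modn^~ S) e1; rewrite ![(S * _)%N]mulnC !modnMDl !modn_small.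
split=> //; move: e1 e2; rewrite ii' => /addIn /eqP; rewrite eqn_pmul2l // => /eqP e1 /eqP.
rewrite eqn_pmul2l // => /eqP e2.
case: u u' e1 e2 => [[x y]|] [[x' y']|] //= [e1] e2.
by congr (Some (_, _)); apply: val_inj.
Qed.

Definition cpoints (y : U -> nat) : seq (R * R) :=
  [seq pt u i | u <- enum {: U}, i <- iota 0 (y u)].

Definition config (y : U -> nat) : {fset R * R} := [fset p in cpoints y].

Lemma cpoints_uniq y : (forall u, y u <= S)%N -> uniq (cpoints y).
Proof.
move=> yS; apply: allpairs_uniq_dep; first exact: enum_uniq.
  by move=> u _; exact: iota_uniq.
move=> /= [u i] [u' i'] /allpairsPdep[w [j [_ + /= [-> ->]]]] /allpairsPdep[w' [j' [_ + /= [-> ->]]]] /=.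
rewrite !mem_iota !add0n /= => jy jy' eq_pt.
have [uu' jj'] := pt_inj (leq_trans jy (yS w)) (leq_trans jy' (yS w')) eq_pt.
by rewrite uu' jj'.
Qed.

Lemma config_sum (M : nmodType) y (F : R * R -> M) : (forall u, y u <= S)%N ->
  \sum_(p <- config y) F p = \sum_u \sum_(0 <= i < y u) F (pt u i).
Proof.
move=> yS; have -> : \sum_(p <- config y) F p = \sum_(p <- cpoints y) F p.
  apply: perm_big; apply: uniq_perm; [exact: fset_uniq | exact: cpoints_uniq|].
  by move=> p; rewrite in_fset.
rewrite /cpoints big_allpairs_dep big_enum /=; apply: eq_bigr => u _.
by rewrite /index_iota subn0.
Qed.

Lemma card_config y : (forall u, y u <= S)%N -> #|` config y| = (\sum_u y u)%N.
Proof.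
move=> yS; rewrite card_fseq undup_id ?cpoints_uniq // size_allpairs_dep.
rewrite sumnE big_map big_enum /=; apply: eq_bigr => u _; exact: size_iota.
Qed.

Lemma mem_config y x : (forall u, y u <= S)%N ->
  (x \in config y)%:R = \sum_u \sum_(0 <= i < y u) (x == pt u i)%:R :> R.
Proof.
by move=> yS; rewrite -(config_sum (fun p => (x == p)%:R)) // sum_uniq_indicator // fset_uniq.
Qed.

Definition add_at (b : U -> nat) (u w : U) : nat := (b w + (w == u))%N.

Lemma add_at_le b u w : (\sum_w b w)%N = s.-1 -> (add_at b u w <= S)%N.
Proof.
move=> bs; rewrite /add_at; apply: (@leq_trans (s.-1 + 1)); last by lia.
by rewrite leq_add ?leq_b1 // -bs (bigD1 w) //= leq_addr.
Qed.

Lemma sum_add_at b u : (\sum_w b w)%N = s.-1 -> (\sum_w add_at b u w)%N = s.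
Proof.
move=> bs; rewrite big_split /= bs (bigD1 u) //= eqxx big1 ?addn0 ?addn1 ?prednK // => w.
by move/negbTE ->.
Qed.

Lemma l1dist_pt u u' i i' : (i <= s)%N -> (i' <= s)%N ->
  l1dist (pt u i) (pt u' i') / s%:R <=
  32 * (`|(col u)%:R - (col u')%:R| + `|(row u)%:R - (row u')%:R|) + 1.
Proof.
move=> i_le i'_le; have s0 : 0 < s%:R :> R by rewrite ltr0n.
rewrite ler_pdivrMr // /l1dist /pt /=.
have -> : (S * col u + i)%:R - (S * col u' + i')%:R =
  32 * ((col u)%:R - (col u')%:R) * s%:R + (i%:R - i'%:R) :> R by rewrite !natrD !natrM; ring.
have -> : (S * row u)%:R - (S * row u')%:R = 32 * ((row u)%:R - (row u')%:R) * s%:R :> R.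
  by rewrite !natrM; ring.
have ii' : `|i%:R - i'%:R| <= s%:R :> R.
  have : (i%:R : R) <= s%:R by rewrite ler_nat.
  have : (i'%:R : R) <= s%:R by rewrite ler_nat.
  have : 0 <= i%:R :> R by []. have : 0 <= i'%:R :> R by [].
  by move=> *; rewrite ler_norml; apply/andP; split; lra.
have := ler_normD (32 * ((col u)%:R - (col u')%:R) * s%:R) (i%:R - i'%:R : R).
rewrite !normrM !(ger0_norm (ler0n _ _)); lra.
Qed.

(** The configurations differ by the last point of two clusters. Moving this mass [1/s] costs 32 per
    unit of grid distance, plus at most 1 for the shifts inside the clusters. *)
Lemma EMD_config_le b u u' : (\sum_w b w)%N = s.-1 ->
  (EMD (@l1dist R) (unif R (config (add_at b u))) (unif R (config (add_at b u'))) <=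
   (32 * (`|(col u)%:R - (col u')%:R| + `|(row u)%:R - (row u')%:R|) + 1)%:E)%E.
Proof.
move=> bs.
have b_le w : (b w <= s)%N by rewrite (leq_trans _ (leq_pred s)) // -bs (bigD1 w) //= leq_addr.
apply: (@le_trans _ _ (l1dist (pt u (b u)) (pt u' (b u')) / s%:R)%:E).
  apply: EMD_swap_le => [||x].
  - by rewrite card_config ?sum_add_at // => w; exact: add_at_le.
  - by rewrite card_config ?sum_add_at // => w; exact: add_at_le.
  have memE w : (x \in config (add_at b w))%:R =
      \sum_w \sum_(0 <= i < b w) (x == pt w i)%:R + (x == pt w (b w))%:R :> R.
    rewrite mem_config => [|z]; last exact: add_at_le.
    rewrite (bigD1 w) //= [in RHS](bigD1 w) //= /add_at eqxx addn1 big_nat_recr //= addrAC.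
    congr (_ + _ + _); apply: eq_bigr => z /negbTE ->; by rewrite addn0.
  by rewrite !memE opprD addrACA subrr add0r.
by rewrite lee_fin l1dist_pt.
Qed.

Lemma EMD_config_ge f y y' : lip1 f -> (forall u, y u <= S)%N -> (forall u, y' u <= S)%N ->
  (\sum_u y u)%N = s -> (\sum_u y' u)%N = s ->
  (((\sum_u \sum_(0 <= i < y' u) f (pt u i) - \sum_u \sum_(0 <= i < y u) f (pt u i)) / s%:R)%:E <=
   EMD (@l1dist R) (unif R (config y')) (unif R (config y)))%E.
Proof.
by move=> f1 yS y'S ys y's; rewrite -!config_sum //; apply: EMD_ge; rewrite ?card_config.
Qed.

(** * Transportation cost of a Haar measure *)

Section Haar.
Variables (k : nat) (eps : {ffun V -> bool}).
Hypothesis k_gt0 : (0 < k)%N.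
Local Notation h := (4 * k)%N.

(** Centre of the block with index [B]; the successor accounts for the column of the reservoir.
    Indices beyond the actual blocks give centres farther out on the same mesh. *)
Definition centre (B : V) : R * R := ((S * (B.1 * h + 2 * k).+1)%:R, (S * (B.2 * h + 2 * k))%:R).

Definition block_sign (B : V) : bool := eps (inord (B.1 %/ 2), B.2) (+) odd B.1.

Definition block_of (v : V) : V := (inord (v.1 %/ h), inord (v.2 %/ h)).

Definition test_fun : R * R -> R := tents centre (S * (2 * k))%:R block_sign.

Lemma natr_dist_ge (a b m : nat) : (m + a <= b)%N || (m + b <= a)%N -> m%:R <= `|a%:R - b%:R : R|.
Proof.
case/orP; rewrite -(ler_nat R) natrD => le; rewrite ler_normr; apply/orP; [right|left]; lra.
Qed.

Lemma far_centre B B' : B != B' -> 2 * (S * (2 * k))%:R <= l1dist (centre B) (centre B').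
Proof.
case: B B' => [a b] [a' b'] neq.
have E : 2 * (S * (2 * k))%:R = (S * h)%:R :> R by rewrite -natrM; congr (_%:R); lia.
have lt_mul (i j : nat) : i != j -> (h + i * h <= j * h)%N || (h + j * h <= i * h)%N.
  rewrite neq_ltn => /orP[] ij; apply/orP; [left|right]; by rewrite -mulSn leq_mul2r ij orbT.
rewrite E /l1dist /centre /=.
have [ea|na] := eqVneq (a : nat) a'; last first.
  apply: le_trans (_ : `|(S * (a * h + 2 * k).+1)%:R - (S * (a' * h + 2 * k).+1)%:R : R| <= _).
    by apply: natr_dist_ge; rewrite -!mulnDr !leq_pmul2l ?muln_gt0 //; have := lt_mul _ _ na; lia.
  by rewrite lerDl.
have nb : (b : nat) != b'.
  by apply: contraNneq neq => eb; apply/eqP; congr (_, _); apply: val_inj.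
apply: le_trans (_ : `|(S * (b * h + 2 * k))%:R - (S * (b' * h + 2 * k))%:R : R| <= _).
  by apply: natr_dist_ge; rewrite -!mulnDr !leq_pmul2l ?muln_gt0 //; have := lt_mul _ _ nb; lia.
by rewrite lerDr.
Qed.

Lemma test_fun_lip1 : lip1 test_fun.
Proof. exact/tents_lip1/far_centre. Qed.

Lemma inord_divK (x : 'I_n) d : (inord (x %/ d) : 'I_n) = (x %/ d)%N :> nat.
Proof. by rewrite inordK //; apply: leq_ltn_trans (leq_div _ _) (ltn_ord x). Qed.

Lemma block_sign_of v : block_sign (block_of v) = hsgn h eps v.
Proof.
rewrite /block_sign /hsgn /block /= inord_divK -divnMA mulnC.
by congr (eps (_, _) (+) _).
Qed.

(** Value at [v] of the tent of its block. Truncated subtraction encodes the absolute values, as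
    [(a - b) + (b - a)], and the positive part. *)
Definition height (v : V) : R :=
  (S * (2 * k - ((v.1 %% h - 2 * k) + (2 * k - v.1 %% h)) -
        ((v.2 %% h - 2 * k) + (2 * k - v.2 %% h))))%:R.

Lemma natr_distE (a b : nat) : `|a%:R - b%:R : R| = ((a - b) + (b - a))%:R.
Proof.
have [ab|/ltnW ba] := leqP a b.
  by rewrite (eqP ab) add0n distrC ger0_norm ?subr_ge0 ?ler_nat // natrB.
by rewrite (eqP ba) addn0 ger0_norm ?subr_ge0 ?ler_nat // natrB.
Qed.

Lemma test_fun_pt v : test_fun (pt (Some v) 0) = (-1) ^+ hsgn h eps v * height v.
Proof.
have h0 : (0 < h)%N by rewrite muln_gt0.
rewrite -block_sign_of /test_fun (@tentsE _ _ _ _ _ (block_of v)) => [|B neq].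
  congr (_ * _); rewrite /tent /l1dist /pt /centre /=  !natr_distE addn0 !inord_divK.
  have dx x : (x - (x %/ h * h + 2 * k) + (x %/ h * h + 2 * k - x) =
      (x %% h - 2 * k) + (2 * k - x %% h))%N.
    by rewrite {1 4}(divn_eq x h) !subnDl.
  rewrite -!mulnBr -!mulnDr -natrD -mulnDr !subSS !dx /height.
  set p := (_ + _ + _)%N.
  have [le|/ltnW le] := leqP p (2 * k).
    rewrite -natrB ?leq_mul2l ?le ?orbT // max_r // -mulnBr; congr ((_ * _)%:R).
    by rewrite /p; lia.
  rewrite max_l; last by rewrite subr_le0 ler_nat leq_mul2l le orbT.
  by rewrite (_ : (_ - _ - _)%N = 0%N) ?muln0 //; move: le; rewrite /p; lia.
apply/eqP; rewrite /tent eq_le le_max lexx andbT ge_max lexx /= subr_le0.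
case: B neq => a b neq; rewrite /l1dist /pt /centre /= addn0.
have apart (x : 'I_n) (c : 'I_n) : c != inord (x %/ h) ->
    (2 * k + x <= c * h + 2 * k)%N || (2 * k + (c * h + 2 * k) <= x)%N.
  move=> neqc; have : (c : nat) != (x %/ h)%N.
    by rewrite -(inord_divK x h); apply: contraNneq neqc => /val_inj ->.
  rewrite neq_ltn => /orP[] lt; apply/orP; [right|left].
    have : (c.+1 * h <= x %/ h * h)%N by rewrite leq_mul2r lt orbT.
    have := leq_trunc_div x h; rewrite mulSn; lia.
  have : ((x %/ h).+1 * h <= c * h)%N by rewrite leq_mul2r lt orbT.
  have := ltn_ceil x h0; lia.
have [ea|na] := eqVneq a (inord (v.1 %/ h)); last first.
  apply: le_trans (_ : `|(S * v.1.+1)%:R - (S * (a * h + 2 * k).+1)%:R : R| <= _); last by rewrite lerDl.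
  by apply: natr_dist_ge; rewrite -!mulnDr !leq_pmul2l ?muln_gt0 //; have := apart _ _ na; lia.
have nb : b != inord (v.2 %/ h).
  by apply: contraNneq neq => eb; rewrite ea eb.
apply: le_trans (_ : `|(S * v.2)%:R - (S * (b * h + 2 * k))%:R : R| <= _); last by rewrite lerDr.
by apply: natr_dist_ge; rewrite -!mulnDr !leq_pmul2l ?muln_gt0 //; have := apart _ _ nb; lia.
Qed.

Lemma sum_modn (m d : nat) (G : nat -> nat) :
  (\sum_(0 <= x < m * d) G (x %% d) = m * \sum_(0 <= r < d) G r)%N.
Proof.
elim: m => [|m IHm]; first by rewrite big_geq.
have -> : (m.+1 * d = m * d + d)%N by rewrite mulSn addnC.
rewrite (@big_cat_nat _ _ _ (m * d)) ?leq_addr //= IHm.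
rewrite -[X in (_ + \sum_(X <= _ < _) _)%N]add0n big_addn addKn.
rewrite mulSn addnC; congr (_ + _)%N; rewrite !big_nat; apply: eq_bigr => r /andP[_ rd].
by rewrite addnC modnMDl modn_small.
Qed.

Lemma sum_triangle m : (m * m <= 2 * \sum_(0 <= i < m) (m - i))%N.
Proof.
elim: m => [|m IHm]; first by rewrite big_geq.
rewrite big_nat_recl // subn0; under eq_bigr do rewrite subSS; lia.
Qed.

(** In each block it suffices to keep the offsets [(2k + i, 2k + j)] with [i, j < k]: there the
    height is [S ((k - i) + (k - j))], which sums to at least [S k^3]. There are [m^2] blocks, and
    [n^2 k = 16 m^2 k^3]. *)
Lemma sum_height m : n = (h * m)%N -> (S * k * (n * n))%:R <= 16 * \sum_v height v.
Proof.
move=> nE; rewrite sum_pairE.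
pose G a b := (2 * k - ((a - 2 * k) + (2 * k - a)) - ((b - 2 * k) + (2 * k - b)))%N.
have -> : \sum_x \sum_y height (x, y) = (S * \sum_(0 <= x < n) \sum_(0 <= y < n) G (x %% h) (y %% h))%:R.
  rewrite natrM natr_sum mulr_sumr big_mkord; apply: eq_bigr => x _.
  rewrite natr_sum mulr_sumr big_mkord; apply: eq_bigr => y _.
  by rewrite -natrM.
rewrite -natrM ler_nat.
have sumG : (\sum_(0 <= x < n) \sum_(0 <= y < n) G (x %% h) (y %% h) =
    m * (m * \sum_(0 <= a < h) \sum_(0 <= b < h) G a b))%N.
  rewrite nE mulnC; under eq_bigr => x _ do rewrite (sum_modn m h (G (x %% h)%N)).
  by rewrite (sum_modn m h (fun a => m * \sum_(0 <= b < h) G a b)%N) -big_distrr.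
have Gk : (k * k * k <= \sum_(0 <= a < h) \sum_(0 <= b < h) G a b)%N.
  have sub (F : nat -> nat) : (\sum_(0 <= i < k) F (2 * k + i) <= \sum_(0 <= a < h) F a)%N.
    have <- : (\sum_(2 * k <= i < 2 * k + k) F i = \sum_(0 <= i < k) F (2 * k + i))%N.
      rewrite -[X in (\sum_(X <= _ < _) _)%N]add0n big_addn addKn.
      by apply: eq_bigr => i _; rewrite addnC.
    rewrite [leqRHS](@big_cat_nat _ _ _ (2 * k)) //=; last by lia.
    rewrite [X in (_ <= _ + X)%N](@big_cat_nat _ _ _ (2 * k + k)) //=; [|by lia..].
    by rewrite addnCA leq_addr.
  apply: leq_trans (sub _); apply: (@leq_trans (\sum_(0 <= i < k) \sum_(0 <= j < k) (2 * k - i - j))).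
    rewrite (_ : (\sum_(0 <= i < k) \sum_(0 <= j < k) (2 * k - i - j) =
      \sum_(0 <= i < k) \sum_(0 <= j < k) ((k - i) + (k - j)))%N); last first.
      rewrite !big_nat; apply: eq_bigr => i /andP[_ ik].
      by rewrite !big_nat; apply: eq_bigr => j /andP[_ jk]; lia.
    under eq_bigr do rewrite big_split /= sum_nat_const_nat subn0.
    rewrite big_split /= sum_nat_const_nat subn0 -big_distrr /=.
    have := sum_triangle k; move: (\sum_(0 <= i < k) (k - i))%N => T; nia.
  apply: leq_sum => i _; apply: leq_trans (sub _); apply: leq_sum => j _.
  by rewrite /G; lia.
rewrite sumG nE.
have : (m * (m * (k * k * k)) <= m * (m * \sum_(0 <= a < h) \sum_(0 <= b < h) G a b))%N.
  by rewrite !leq_mul2l Gk !orbT.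
move: (m * (m * \sum_(0 <= a < h) \sum_(0 <= b < h) G a b))%N => T le.
have -> : (S * k * (h * m * (h * m)) = S * (16 * (m * (m * (k * k * k)))))%N by ring.
by rewrite mulnCA leq_mul2l leq_mul2l le !orbT.
Qed.

(** Each point added or removed at [v] gains at least [height v - s], the loss [s] coming from the
    shifts inside a cluster. With mesh [32 * s] the heights sum to at least [2 s k n^2], and the
    total loss [s n^2] leaves [s k n^2]. *)
Lemma EMD_haar_ge m t (y y' : U -> nat) : n = (h * m)%N ->
  (forall u, y u <= s)%N -> (forall u, y' u <= s)%N ->
  (\sum_u y u)%N = s -> (\sum_u y' u)%N = s -> y' None = y None ->
  (forall v, if hsgn h eps v then y (Some v) = (y' (Some v) + t)%N
             else y' (Some v) = (y (Some v) + t)%N) ->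
  ((t%:R * (n * n * k)%:R)%:E <=
   EMD (@l1dist R) (unif R (config y')) (unif R (config y)))%E.
Proof.
move=> nE ys y's sy sy' yN yt.
have s0 : 0 < s%:R :> R by rewrite ltr0n.
have leS a : (a <= s -> a <= S)%N by lia.
have yS u : (y u <= S)%N by exact/leS/ys.
have y'S u : (y' u <= S)%N by exact/leS/y's.
apply: le_trans (EMD_config_ge test_fun_lip1 yS y'S sy sy').
rewrite lee_fin ler_pdivlMr //.
rewrite !big_optionE yN opprD addrACA subrr add0r -sumrB.
have near v i : (i <= s)%N -> height v - s%:R <= (-1) ^+ hsgn h eps v * test_fun (pt (Some v) i).
  move=> i_le.
  have : `|test_fun (pt (Some v) i) - test_fun (pt (Some v) 0)| <= s%:R.
    apply: le_trans (test_fun_lip1 _ _) _.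
    rewrite /l1dist /pt /= subrr normr0 addr0 addn0 natrD addrAC subrr add0r.
    by rewrite ger0_norm ?ler_nat.
  rewrite test_fun_pt ler_norml => /andP[].
  by case: (hsgn h eps v); rewrite ?expr1 ?expr0; lra.
have step v : t%:R * (height v - s%:R) <=
    \sum_(0 <= i < y' (Some v)) test_fun (pt (Some v) i) -
    \sum_(0 <= i < y (Some v)) test_fun (pt (Some v) i).
  have run a : (a + t <= s)%N -> t%:R * (height v - s%:R) <=
      (-1) ^+ hsgn h eps v * (\sum_(0 <= i < a + t) test_fun (pt (Some v) i) -
      \sum_(0 <= i < a) test_fun (pt (Some v) i)).
    move=> at_le; rewrite (@big_cat_nat _ _ _ a) ?leq_addr //= addrAC subrr add0r mulr_sumr.
    have -> : t%:R * (height v - s%:R) = \sum_(a <= i < a + t) (height v - s%:R).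
      by rewrite sumr_const_nat addKn mulr_natl.
    rewrite !big_nat; apply: ler_sum => i /andP[_ ia]; apply: near.
    exact: leq_trans (ltnW ia) at_le.
  have := yt v; case sv: (hsgn h eps v) => E.
    have := run (y' (Some v)); rewrite -E sv expr1 mulN1r opprB; apply; exact: ys.
  by have := run (y (Some v)); rewrite -E sv expr0 mul1r; apply; exact: y's.
apply: le_trans (ler_sum _ (fun v _ => step v)).
rewrite -mulr_sumr -mulrA ler_wpM2l // sumrB.
have := sum_height nE.
have -> : \sum_(v : V) (s%:R : R) = (n * n * s)%:R.
  by rewrite sumr_const card_prod card_ord -mulrnA mulnC.
have : ((n * n * k)%:R * s%:R : R) * 16 + 16 * (n * n * s)%:R <= (S * k * (n * n))%:R.
  rewrite -!natrM -natrD ler_nat.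
  have -> : (n * n * k * s * 16 + 16 * (n * n * s) = 16 * (n * n * s * (k + 1)))%N by ring.
  have -> : (32 * s * k * (n * n) = 16 * (n * n * s * (2 * k)))%N by ring.
  by rewrite !leq_mul2l; apply/orP; right; apply/orP; right; lia.
lra.
Qed.

End Haar.

End Configurations.

(** * Lattice points as configurations of [s] points *)

Section LatticeOfConfigurations.
Variables (R : realType) (n' s X : nat).
Local Notation n := n'.+1.
Local Notation V := ('I_n * 'I_n)%type.
Local Notation U := (option V).
Local Notation lattice := {ffun V -> int}.
Hypothesis X_le : (n * n * X.+1 <= s)%N.

Definition mass (x : lattice) : nat := (\sum_v `|x v|)%N.

(* All the mass that is not used at the grid points is put in the reservoir [None]. *)
Definition counts (x : lattice) (u : U) : nat :=
  if u is Some v then `|x v|%N else (s - mass x)%N.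

(** The [s - 1] points common to [x] and to all its neighbours [x + unitv v]: the last point goes to
    the reservoir or to the cluster of [v]. *)
Definition counts_base (x : lattice) (u : U) : nat :=
  if u is Some v then `|x v|%N else (s.-1 - mass x)%N.

Lemma s_gt0 : (0 < s)%N.
Proof. by apply: leq_trans X_le; rewrite !muln_gt0. Qed.

Lemma mass_lt x : in_box 0 X%:Z x -> (mass x < s)%N.
Proof.
move=> xbox; apply: (@leq_ltn_trans (n * n * X)); last by move: X_le; rewrite mulnS; lia.
have -> : (n * n)%N = #|{: V}| by rewrite card_prod card_ord.
rewrite -sum_nat_const; apply: leq_sum => v _.
by have := xbox v; move: (x v) => p; clear; lia.
Qed.

Lemma counts_sum x : in_box 0 X%:Z x -> (\sum_u counts x u)%N = s.
Proof. by move/mass_lt => lt; rewrite big_optionE /= subnK // ltnW. Qed.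

Lemma counts_base_sum x : in_box 0 X%:Z x -> (\sum_u counts_base x u)%N = s.-1.
Proof. by move/mass_lt => lt; rewrite big_optionE /= subnK //; have := s_gt0; lia. Qed.

Lemma counts_le x u : in_box 0 X%:Z x -> (counts x u <= s)%N.
Proof. by move/counts_sum => sx; rewrite -[X in (_ <= X)%N]sx (bigD1 u) //= leq_addr. Qed.

Lemma countsE x : in_box 0 X%:Z x -> counts x = add_at (counts_base x) None.
Proof.
move/mass_lt => lt; apply/funext => -[v|]; rewrite /add_at /= ?addn0 //; have := s_gt0; lia.
Qed.

Lemma mass_unit x v : in_box 0 X%:Z x -> mass (x + unitv v) = (mass x).+1.
Proof.
move=> xbox; have E u : `|(x + unitv v)%R u|%N = (`|x u| + (u == v))%N.
  by have := xbox u; rewrite !ffunE; move: (x u) (u == v) => p b; clear; lia.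
rewrite /mass (eq_bigr _ (fun u _ => E u)) big_split /= (bigD1 v) //=.
rewrite [X in (_ + X)%N](bigD1 v) //= eqxx [X in (1 + X)%N]big1 ?addn0 ?addn1 //.
by move=> u /negbTE ->.
Qed.

Lemma counts_unitE x v : in_box 0 X%:Z x ->
  counts (x + unitv v) = add_at (counts_base x) (Some v).
Proof.
move=> xbox; apply/funext => -[u|]; rewrite /add_at /=.
  have := xbox u; rewrite !ffunE -[Some u == Some v]/(u == v).
  by move: (x u) (u == v) => p b; clear; lia.
by rewrite mass_unit // addn0; lia.
Qed.

Definition lattice_config (x : lattice) : {fset R * R} := config R s (counts x).

Lemma card_lattice_config x : in_box 0 X%:Z x -> #|` lattice_config x| = s.
Proof.
move=> xbox; rewrite card_config ?counts_sum //; first exact: s_gt0.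
by move=> u; have := counts_le u xbox; lia.
Qed.

Lemma card_lattice_config_unit x v : in_box 0 X%:Z x -> #|` lattice_config (x + unitv v)| = s.
Proof.
move=> xbox; rewrite /lattice_config counts_unitE //.
have bs := counts_base_sum xbox.
by rewrite card_config ?(sum_add_at s_gt0 _ bs) ?s_gt0 // => u; exact: (add_at_le s_gt0 _ _ bs).
Qed.

Local Notation dist x y := (EMD (@l1dist R) (unif R (lattice_config x)) (unif R (lattice_config y))).

Lemma natr_dist_le (a b m : nat) : (a <= m)%N -> (b <= m)%N -> `|a%:R - b%:R : R| <= m%:R.
Proof.
rewrite -!(ler_nat R) => am bm; have := ler0n R a; have := ler0n R b.
by move=> *; rewrite ler_norml; apply/andP; split; lra.
Qed.

Lemma dist_edge x (e : grid_edge n') : in_box 0 X%:Z x ->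
  (dist (x + unitv (etgt e))%R (x + unitv (esrc e))%R <= 33%:E)%E.
Proof.
move=> xbox; rewrite /lattice_config !counts_unitE //.
apply: le_trans (EMD_config_le R s_gt0 _ _ (counts_base_sum xbox)) _.
rewrite lee_fin /etgt /esrc; case: e => -[] [y i] /=.
  rewrite /bump /= add1n subrr normr0 addr0 -[in X in X - _]natr1 addrAC subrr add0r normr1; lra.
by rewrite /bump /= add1n subrr normr0 add0r -[in X in X - _]natr1 addrAC subrr add0r normr1; lra.
Qed.

(** A point travels between the reservoir and the cluster of [v], over at most [2 n] units of grid
    distance. *)
Lemma dist_unit x v : in_box 0 X%:Z x ->
  (dist (x + unitv v)%R x <= (66 * n%:R)%:E)%E.
Proof.
move=> xbox; rewrite /lattice_config counts_unitE // (countsE xbox).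
apply: le_trans (EMD_config_le R s_gt0 _ _ (counts_base_sum xbox)) _.
rewrite lee_fin /=.
have d1 : `|v.1.+1%:R - 0%:R : R| <= n%:R by apply: natr_dist_le; rewrite ?ltn_ord.
have d2 : `|v.2%:R - 0%:R : R| <= n%:R by apply: natr_dist_le; rewrite // ltnW ?ltn_ord.
have n1 : 1 <= n%:R :> R by rewrite ler1n.
lra.
Qed.

Lemma massE x : in_box 0 X%:Z x -> (mass x)%:Z = \sum_v x v.
Proof.
move=> xbox; rewrite /mass -natz natr_sum; apply: eq_bigr => v _; rewrite natz.
by have := xbox v; move: (x v) => p; clear; lia.
Qed.

Lemma dist_haar k m t eps x : (0 < k)%N -> n = (4 * k * m)%N ->
  \sum_(v : V) (-1) ^+ hsgn (4 * k) eps v = 0 :> int ->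
  in_box 0 X%:Z x -> in_box 0 X%:Z (x + signv (hsgn (4 * k) eps) *+ t) ->
  ((t%:R * (n * n * k)%:R)%:E <= dist (x + signv (hsgn (4 * k) eps) *+ t)%R x)%E.
Proof.
move=> k0 nE sum0 xbox ybox.
set y := x + _ in ybox *.
have jump v : if hsgn (4 * k) eps v then `|x v|%N = (`|y v| + t)%N else `|y v|%N = (`|x v| + t)%N.
  have := xbox v; have := ybox v; rewrite /y !ffunE ffunMnE !ffunE; move: (x v) => p.
  by case: (hsgn _ _ _); rewrite ?expr0 ?expr1; clear; lia.
(* The signs sum to zero, so the reservoir keeps its mass. *)
have mass_eq : mass y = mass x.
  have : (mass y)%:Z = (mass x)%:Z.
    rewrite !massE // /y.
    under eq_bigr do rewrite ffunE ffunMnE ffunE.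
    by rewrite big_split /= sumrMnl sum0 mul0rn addr0.
  by case.
apply: (@EMD_haar_ge R n' s s_gt0 k eps k0 m t _ _ nE) => //=.
- by move=> u; exact: counts_le.
- by move=> u; exact: counts_le.
- exact: counts_sum.
- exact: counts_sum.
- by rewrite mass_eq.
Qed.

End LatticeOfConfigurations.

(** * The distortion bound *)

Section Distortion.
Variables (R : realType) (n' L s : nat).
Local Notation n := n'.+1.
Local Notation V := ('I_n * 'I_n)%type.
Local Notation lattice := {ffun V -> int}.
Hypothesis nE : n = (4 ^ L.+1)%N.
Hypothesis L_gt0 : (0 < L)%N.
Hypothesis s_large : (2 ^ (42 + 20 * L) <= s)%N.

(** The sizes of [r] and [t] make the linearization error and the averaging error at most [D n / 4]
    each, and [M] meets the condition of [expn_add_le] for [n^2] coordinates. *)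
Let r' := (528 * n ^ 4).-1%N.
Let r := r'.+1.
Let t := (528 * n ^ 2 * r)%N.
Let M := (4 * t * (n * n))%N.
Let X := (M + 2 * t + r)%N.

Let rE : r = (528 * n ^ 4)%N.
Proof. by rewrite /r prednK // muln_gt0 expn_gt0. Qed.

(** [X + 1] is at most [7 t n^2 = 7 * 528^2 n^8], the constant is below [2^22], and
    [n^10 = 2^(20 + 20 L)]. *)
Lemma lattice_mass_le : (n * n * X.+1 <= s)%N.
Proof.
apply: leq_trans s_large.
have n10 : (n ^ 10 = 2 ^ 20 * 2 ^ (20 * L))%N.
  have e : (2 * (L.+1 * 10) = 20 + 20 * L)%N by lia.
  by rewrite nE -expnM -[4%N]/(2 ^ 2)%N -expnM e expnD.
have -> : (2 ^ (42 + 20 * L) = 2 ^ 22 * n ^ 10)%N.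
  have e : (42 + 20 * L = 22 + (20 + 20 * L))%N by lia.
  by rewrite n10 e !expnD.
have rt : (r.+1 <= t)%N.
  rewrite /t; apply: (@leq_trans (2 * r)); first lia.
  have n2_gt0 : (0 < n ^ 2)%N by rewrite expn_gt0.
  by rewrite leq_mul2r; apply/orP; right; move: (n ^ 2)%N n2_gt0 => p; clear; lia.
have tn : (t <= t * (n * n))%N by rewrite leq_pmulr // muln_gt0.
have -> : (2 ^ 22 * n ^ 10 = (n * n) * (2 ^ 22 * n ^ 8))%N by rewrite mulnCA; congr (_ * _)%N; ring.
rewrite leq_mul2l; apply/orP; right.
apply: (@leq_trans (7 * (t * (n * n)))); first by rewrite /X /M; lia.
have -> : (t * (n * n) = 528 * 528 * n ^ 8)%N by rewrite /t rE; ring.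
rewrite [(7 * _)%N]mulnA; apply: leq_mul; last exact: leqnn.
rewrite -[22%N]/(11 + 11)%N expnD.
apply: (@leq_trans ((3 * 528) * (3 * 528))); first lia.
by apply: leq_mul.
Qed.

Let t_gt0 : (0 < t)%N. Proof. by rewrite /t !muln_gt0. Qed.

Let cardV : #|{: V}| = (n * n)%N. Proof. by rewrite card_prod card_ord. Qed.

Lemma sum_sign_hsgn i eps : (i < L)%N -> \sum_(v : V) (-1) ^+ hsgn (4 ^ i.+1) eps v = 0 :> int.
Proof.
move=> iL; apply: (@intr_inj R); rewrite rmorph_sum /=.
rewrite -[RHS](@haar_sum_const R n' L nE i.+1 eps 1 iL) /haar_sum; apply: eq_bigr => v _.
by rewrite mulr1 rmorphXn /= rmorphN1.
Qed.

Lemma card_grid_edge : (#|{: grid_edge n'}| <= 2 * (n * n))%N.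
Proof. by rewrite !card_prod card_bool !card_ord leq_mul2l leq_mul2l leqnSn !orbT. Qed.

Lemma errors_le (D : R) : 0 <= D <= n%:R ->
  #|{: V}|%:R * (#|{: V}|%:R * (2 * (D * (66 * n%:R)) / r%:R)) +
  2 * ((#|{: V}| * r)%:R * (D * (66 * n%:R))) / t%:R <= (n * n)%:R / 2.
Proof.
case/andP=> D0 Dn; rewrite cardV /t rE.
have n0 : 0 < n%:R :> R by rewrite ltr0n.
have nn : (n * n)%:R = n%:R * n%:R :> R by rewrite natrM.
have n4 : (528 * n ^ 4)%:R = 528 * n%:R ^+ 4 :> R by rewrite natrM natrX.
have n2 : (528 * n ^ 2)%:R = 528 * n%:R ^+ 2 :> R by rewrite natrM natrX.
rewrite [(n * n * _)%:R]natrM [(528 * n ^ 2 * _)%:R]natrM nn n4 n2.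
set N : R := n%:R in Dn n0 *.
have -> : N * N * (N * N * (2 * (D * (66 * N)) / (528 * N ^+ 4))) +
    2 * (N * N * (528 * N ^+ 4) * (D * (66 * N))) / (528 * N ^+ 2 * (528 * N ^+ 4)) =
    D * N / 2.
  by field; rewrite gt_eqF.
by rewrite ler_wpM2r // ler_wpM2r // ltW.
Qed.

Lemma distortion_ge (D : R) : 1 <= D -> D <= n%:R ->
  L1_embeds_with (@M2dist R s) D -> L%:R <= 9504 * D.
Proof.
move=> D1 Dn [d [T [mu [F [Fint Fdist]]]]].
have D0 : 0 <= D by apply: le_trans D1.
have s0 : (0 < s)%N := s_gt0 lattice_mass_le.
have box0 : in_box 0 X%:Z (0 : lattice) by move=> v; rewrite ffunE.
(* Value of [cfg] at lattice points whose configuration does not have exactly [s] points. *)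
pose dflt : {A : {fset R * R} | #|` A| == s} :=
  exist _ (lattice_config R s 0) (introT eqP (card_lattice_config R lattice_mass_le box0)).
have [cfg cfgE] : exists cfg : lattice -> M2 R s,
    forall x, #|` lattice_config R s x| = s -> val (cfg x) = lattice_config R s x.
  by exists (fun x => insubd dflt (lattice_config R s x)) => x cx; rewrite insubdK //; apply/eqP.
have cfg_val x : in_box 0 X%:Z x -> val (cfg x) = lattice_config R s x.
  by move=> xbox; apply/cfgE/(card_lattice_config R lattice_mass_le xbox).
have cfg_unit_val x v : in_box 0 X%:Z x -> val (cfg (x + unitv v)) = lattice_config R s (x + unitv v).
  by move=> xbox; apply/cfgE/(card_lattice_config_unit R lattice_mass_le v xbox).
have phiP x : F (cfg x) \in integrable_pred mu by apply/asboolP; exact: Fint.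
pose phi (x : lattice) : intfun mu := IntFun (phiP x).
have normE x y : (L1norm (phi x - phi y))%:E = (\int[mu]_t (`|F (cfg x) t - F (cfg y) t|)%:E)%E.
  rewrite /L1norm /Rintegral fineK.
    by apply: eq_integral => z _; rewrite intfunB.
  by apply: integrable_fin_num => //; exact: integrable_normr_intfun.
have up x y a : (M2dist (cfg x) (cfg y) <= a%:E)%E -> L1norm (phi x - phi y) <= D * a.
  move=> le; rewrite -lee_fin normE; apply: le_trans (Fdist _ _).2 _.
  by rewrite EFinM lee_wpmul2l // lee_fin.
have low x y a : (a%:E <= M2dist (cfg x) (cfg y))%E -> a <= L1norm (phi x - phi y).
  by move=> le; rewrite -lee_fin normE; apply: le_trans le (Fdist _ _).1.
have E0_ge0 : 0 <= D * (66 * n%:R) by rewrite !mulr_ge0.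
have e0_ge0 : 0 <= D * 33 by rewrite !mulr_ge0.
have M_gt0 : (0 < M)%N by rewrite !muln_gt0.
have M_large : ((M + 2 * t) ^ #|{: V}| <= 2 * M ^ #|{: V}|)%N.
  by apply: expn_add_le => //; rewrite cardV.
have edge x e : in_box 0 X%:Z x ->
    L1norm (phi (x + unitv (etgt e)) - phi (x + unitv (esrc e))) <= D * 33.
  move=> xbox; apply: up; rewrite /M2dist (cfg_unit_val _ (etgt e) xbox) (cfg_unit_val _ (esrc e) xbox).
  exact: (@dist_edge R n' s X lattice_mass_le x e xbox).
have unit x v : in_box 0 X%:Z x -> L1norm (phi (x + unitv v) - phi x) <= D * (66 * n%:R).
  move=> xbox; apply: up; rewrite /M2dist (cfg_unit_val _ _ xbox) (cfg_val _ xbox).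
  exact: (@dist_unit R n' s X lattice_mass_le x v xbox).
pose J := ('I_L * {ffun V -> bool})%type.
pose sg (j : J) := hsgn (4 ^ j.1.+1) j.2.
have lower x (j : J) : in_box 0 X%:Z x -> in_box 0 X%:Z (x + signv (sg j) *+ t) ->
    t%:R * (n * n * 4 ^ j.1)%:R <= L1norm (phi (x + signv (sg j) *+ t) - phi x).
  move=> xbox ybox; apply: low.
  rewrite /M2dist (cfg_val _ xbox) (cfg_val _ ybox).
  move: xbox ybox; rewrite /sg expnS => xbox ybox.
  apply: (@dist_haar R n' s X lattice_mass_le (4 ^ j.1) (4 ^ (L - j.1))) => //.
  - by rewrite expn_gt0.
  - by apply: (etrans nE); rewrite -expnS -expnD; congr (4 ^ _)%N; have := ltn_ord j.1; lia.
  - by rewrite -expnS; exact: sum_sign_hsgn.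
pose beta (j : J) : R := (4 ^ j.1.+1)%:R^-1.
have beta_ge0 j : 0 <= beta j by rewrite invr_ge0.
pose K : R := #|{ffun V -> bool}|%:R.
have K_gt0 : 0 < K by rewrite ltr0n; apply/card_gt0P; exists [ffun=> false].
have C_ge0 : 0 <= K * 9 by rewrite mulr_ge0 // ltW.
have lin (g : V -> intfun mu) : \sum_j beta j * L1norm (\sum_v (-1) ^+ sg j v *: g v) <=
    K * 9 * \sum_e L1norm (g (etgt e) - g (esrc e)) := haar_sum_intfun_le g nE.
have := poincare_linearized (L1norm_seminorm mu) beta_ge0 C_ge0 lin t_gt0 M_gt0 M_large
  E0_ge0 e0_ge0 edge unit lower.
have err : 0 <= D <= n%:R by rewrite D0.
have {}err := errors_le err.
set err2 := (X in X + _ <= _) in err; set err1 := (X in _ + X <= _) in err.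
move=> poincare.
have L0 : 0 < L%:R :> R by rewrite ltr0n.
have N0 : 0 < (n * n)%:R :> R by rewrite ltr0n muln_gt0.
(* With [p = 4 ^ j.1], each of the [K L] indices contributes at least
   [(n^2 p - n^2 / 2) / (4 p) >= n^2 / 8]. The constant 9504 is [8 * 2 * 9 * 2 * 33]. *)
have : K * L%:R * ((n * n)%:R / 8) <= 2 * (K * 9) * ((2 * (n * n))%:R * (D * 33)).
  apply: (@le_trans _ _ (2 * (K * 9) * (#|{: grid_edge n'}|%:R * (D * 33)))); last first.
    by rewrite ler_wpM2l ?mulr_ge0 ?(ltW K_gt0) // ler_wpM2r // ler_nat card_grid_edge.
  apply: le_trans poincare.
  have -> : K * L%:R * ((n * n)%:R / 8) = \sum_(j : J) (n * n)%:R / 8.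
    by rewrite sumr_const card_prod card_ord -[RHS]mulr_natl [(L * _)%:R]natrM -/K [K * _]mulrC.
  apply: ler_sum => j _; rewrite -addrA -opprD -/err1 -/err2.
  have p1 : 1 <= (4 ^ j.1)%:R :> R by rewrite ler1n expn_gt0.
  rewrite /beta expnS natrM ler_pdivlMl ?mulr_gt0 ?(lt_le_trans _ p1) // [(n * n * _)%:R]natrM.
  have : (n * n)%:R <= (n * n)%:R * (4 ^ j.1)%:R :> R by rewrite ler_peMr // ltW.
  move: err; lra.
rewrite natrM => fin.
rewrite -(ler_pM2l K_gt0) -(ler_pM2r N0).
lra.
Qed.

End Distortion.

Theorem theorem5p2 (R : realType) :
  exists c : R, 0 < c /\
  exists s0 : nat, forall s : nat, (s0 <= s)%N ->
    ((c * ln (s%:R : R))%:E <= c1 (@M2dist R s))%E.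
Proof.
have c0 : 0 < 9504 * 248 :> R by apply: mulr_gt0; rewrite ltr0n.
exists (9504 * 248)^-1; split; first by rewrite invr_gt0.
exists (2 ^ 62)%N => s s_ge.
have s_gt0 : (0 < s)%N by apply: leq_trans s_ge; rewrite expn_gt0.
(* As [L >= 1], one has [42 + 20 L <= 62 L <= l], so [s] is large enough for the scale count [L],
   while [l + 1 <= 124 L] keeps [L] of order [log s]. *)
pose l := trunc_log 2 s; pose L := (l %/ 62)%N.
have l62 : (62 <= l)%N by rewrite trunc_log_max.
have L_gt0 : (0 < L)%N by rewrite divn_gt0.
have lL : (62 * L <= l)%N by rewrite mulnC leq_trunc_div.
have Ll : (l.+1 <= 124 * L)%N.
  have : (l < L.+1 * 62)%N by rewrite ltn_ceil.
  by move: (L) L_gt0 => p; clear; lia.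
have s_large : (2 ^ (42 + 20 * L) <= s)%N.
  apply: leq_trans (trunc_logP (isT : (1 < 2)%N) s_gt0); rewrite leq_exp2l // -/l.
  by move: (L) (l) L_gt0 lL => p q; clear; lia.
have nE : (4 ^ L.+1).-1.+1 = (4 ^ L.+1)%N by rewrite prednK // expn_gt0.
have ln_s : ln (s%:R : R) <= 248 * L%:R.
  apply: (@le_trans _ _ (ln ((2 : R) ^+ l.+1))).
    rewrite ler_ln ?posrE ?exprn_gt0 ?ltr0n // -natrX ler_nat ltnW //.
    exact: trunc_log_ltn.
  rewrite lnXn // -[ln 2 *+ _]mulr_natr.
  have ln2 : ln 2 <= 2 :> R by rewrite ltW // ln_sublinear.
  have lR : l.+1%:R <= 124 * L%:R :> R by rewrite -natrM ler_nat.
  apply: (@le_trans _ _ (2 * l.+1%:R)); first by rewrite ler_wpM2r.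
  by rewrite (_ : 248 * L%:R = 2 * (124 * L%:R)) ?ler_wpM2l //; ring.
apply: le_ereal_inf_tmp => _ [D [D1 emb] <-]; rewrite lee_fin.
(* A smaller [D] would satisfy [9504 D < L], in particular [D <= n], against [distortion_ge]. *)
rewrite ler_pdivrMl // leNgt; apply/negP => lt.
have Dlt : 9504 * D < L%:R.
  rewrite -(ltr_pM2l (ltr0n R 248)) mulrA [248 * 9504]mulrC; exact: lt_le_trans lt ln_s.
have DL : D <= L%:R.
  apply: le_trans (ltW Dlt); apply: ler_peMl; [exact: le_trans D1 | by rewrite ler1n].
have Dn : D <= (4 ^ L.+1).-1.+1%:R.
  by rewrite nE; apply: le_trans DL _; rewrite ler_nat ltnW // ltnW // ltn_expl.
have := distortion_ge nE L_gt0 s_large D1 Dn emb; rewrite leNgt => /negP; exact.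
Qed.
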